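(* Let $X,U,Y$ be complex Banach spaces, $1\le p<\infty$, $B(\cdot)\in L^\infty(\mathbb R_+,\mathcal L_s(U,X))$, $C(\cdot)\in L^\infty(\mathbb R_+,\mathcal L_s(X,Y))$, and let $\mathcal U=\{U(t,\tau)\}_{t\ge\tau}$ be a strongly continuous exponentially bounded evolution family on $X$. Consider the system $$x(t)=U(t,s)x(s)+\int_s^tU(t,\tau)B(\tau)u(\tau)\,d\tau,\quad y(t)=C(t)x(t),\quad t\ge s\ge0.\qquad(\ast)$$ The following are equivalent: (i) $\mathcal U$ is exponentially stable on $X$; (ii) $\mathbb G$ is a bounded operator on $L^p(\mathbb R_+,X)$; (iii) system $(\ast)$ is stabilizable and $\mathbb G\mathcal B$ is a bounded operator from $L^p(\mathbb R_+,U)$ to $L^p(\mathbb R_+,X)$; (iv) system $(\ast)$ is detectable and $\mathcal C\mathbb G$ is a bounded operator from $L^p(\mathbb R_+,X)$ to $L^p(\mathbb R_+,Y)$; (v) system $(\ast)$ is stabilizable and detectable and $\mathbb L=\mathcal C\mathbb G\mathcal B$ is a bounded operator from $L^p(\mathbb R_+,U)$ to $L^p(\mathbb R_+,Y)$.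
   Context: $\mathbb R_+=[0,\infty)$. For Banach spaces $V,W$, $L^\infty(\mathbb R_+,\mathcal L_s(V,W))$ is the set of (essentially) bounded functions $D:\mathbb R_+\to\mathcal L(V,W)$ such that $t\mapsto D(t)v$ is strongly measurable for each $v\in V$. An evolution family on $X$ is a family $\{U(t,\tau)\}_{t\ge\tau\ge0}$ of bounded linear operators on $X$ such that $U(t,\tau)=U(t,s)U(s,\tau)$ and $U(t,t)=I$ for $t\ge s\ge\tau$, and for each $x\in X$ the map $(t,\tau)\mapsto U(t,\tau)x$ is continuous for $t\ge\tau$. It is exponentially bounded if there are $M\ge1$, $\omega\in\mathbb R$ with $\|U(t,\tau)\|\le Me^{\omega(t-\tau)}$ for all $t\ge\tau$; it is exponentially stable if this holds with some $\omega<0$. $(\mathbb Gf)(t)=\int_0^tU(t,\tau)f(\tau)\,d\tau$ for $f\in L^1_{loc}(\mathbb R_+,X)$; $(\mathcal Bu)(t)=B(t)u(t)$, $(\mathcal Cf)(t)=C(t)f(t)$. An operator being bounded between $L^p$ spaces includes that it maps the first space into the second. System $(\ast)$ is stabilizable if there exist $F(\cdot)\in L^\infty(\mathbb R_+,\mathcal L_s(X,U))$ and an exponentially stable evolution family $\{U_{BF}(t,\tau)\}_{t\ge\tau}$ such that for $t\ge s$, $x\in X$: $U_{BF}(t,s)x=U(t,s)x+\int_s^tU(t,\tau)B(\tau)F(\tau)U_{BF}(\tau,s)x\,d\tau$. System $(\ast)$ is detectable if there exist $K(\cdot)\in L^\infty(\mathbb R_+,\mathcal L_s(Y,X))$ and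 an exponentially stable evolution family $\{U_{KC}(t,\tau)\}_{t\ge\tau}$ such that for $t\ge s$, $x\in X$: $U_{KC}(t,s)x=U(t,s)x+\int_s^tU_{KC}(t,\tau)K(\tau)C(\tau)U(\tau,s)x\,d\tau$. *)

(* Defs.v *)
From mathcomp Require Import all_boot all_order all_algebra.
From mathcomp Require Import all_classical all_reals all_analysis.
From mathcomp Require Import complex.
Import Order.TTheory GRing.Theory Num.Theory.
Import numFieldNormedType.Exports.

Set Implicit Arguments.
Unset Strict Implicit.
Unset Printing Implicit Defensive.

Local Open Scope classical_set_scope.
Local Open Scope ring_scope.
Local Open Scope complex_scope.

(* The norm of a normed space over R[i] is R[i]-valued (with real nonnegative
   values); rnorm is the same norm, read in R. *)
Definition rnorm (R : realType) (V : normedModType R[i]) (x : V) : R :=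
  complex.Re `|x|.

Section BoundedOperators.
Context {R : realType} {V W : normedModType R[i]}.

(* For 0 <= c this says that the operator norm of T is at most c. *)
Definition opnorm_le (T : V -> W) (c : R) : Prop :=
  forall x, rnorm (T x) <= c * rnorm x.

Definition bounded_operator (T : V -> W) : Prop :=
  linear T /\ exists c, opnorm_le T c.

End BoundedOperators.

Section Bochner.
Context d (T : measurableType d) (R : realType) (mu : {measure set T -> \bar R}).
Context (V : normedModType R[i]).
Implicit Types (E : set T) (s f : T -> V).

Definition simple_function s : Prop :=
  finite_set (range s) /\ forall v, measurable (s @^-1` [set v]).

Definition strongly_measurable E f : Prop :=
  exists s_ : nat -> T -> V, (forall n, simple_function (s_ n)) /\
    {ae mu, forall t, E t -> s_ n t @[n --> \oo] --> f t}.

Definition integrable_simple_function E s : Prop :=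
  simple_function s /\
  forall v, v != 0 -> (mu (E `&` s @^-1` [set v]) < +oo)%E.

Definition simple_integral E s : V :=
  \sum_(v \in range s) (fine (mu (E `&` s @^-1` [set v])))%:C *: v.

Definition has_bochner_integral E f (v : V) : Prop :=
  strongly_measurable E f /\
  exists s_ : nat -> T -> V,
    [/\ forall n, integrable_simple_function E (s_ n),
        (\int[mu]_(t in E) (rnorm (f t - s_ n t))%:E)%E @[n --> \oo] --> 0%E &
        simple_integral E (s_ n) @[n --> \oo] --> v].

(* The Bochner integral of f over E, with value 0 if f is not integrable. *)
Definition bochner_integral E f : V := xget 0 [set v | has_bochner_integral E f v].

End Bochner.

Section HalfLine.
Context {R : realType}.
Local Notation mu := (@lebesgue_measure R).

Definition Rplus : set R := `[0, +oo[.

(* Functions on [0, +oo[, and families indexed by t >= tau >= 0, are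
   represented by functions on all of R, resp. R * R, whose values outside
   the intended domain are irrelevant. *)

Section Spaces.
Context {V W : normedModType R[i]}.

Definition Linfty_strong (D : R -> V -> W) : Prop :=
  [/\ forall t, 0 <= t -> bounded_operator (D t),
      forall v, strongly_measurable mu Rplus (fun t => D t v) &
      exists c, {ae mu, forall t, Rplus t -> opnorm_le (D t) c}].

Definition Lp_norm (p : R) (f : R -> V) : \bar R :=
  Lnorm mu p%:E ((fun t => (rnorm (f t))%:E) \_ Rplus).

Definition in_Lp (p : R) (f : R -> V) : Prop :=
  strongly_measurable mu Rplus f /\ (Lp_norm p f < +oo)%E.

End Spaces.

(* Elements of L^p are represented by functions, hence linearity is required
   up to equality almost everywhere; together with the norm estimate it makes
   A compatible with equality almost everywhere. *)
Definition Lp_bounded_operator {V W : normedModType R[i]} (p : R)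
    (A : (R -> V) -> (R -> W)) : Prop :=
  [/\ forall f, in_Lp p f -> in_Lp p (A f),
      forall (a : R[i]) f g, in_Lp p f -> in_Lp p g ->
        {ae mu, forall t, Rplus t ->
          A (fun r => a *: f r + g r) t = a *: A f t + A g t} &
      exists c : R, forall f, in_Lp p f ->
        (Lp_norm p (A f) <= c%:E * Lp_norm p f)%E].

Section EvolutionFamilies.
Context {X : normedModType R[i]}.
Implicit Types UU : R -> R -> X -> X.

Definition evolution_family UU : Prop :=
  [/\ forall t tau, 0 <= tau <= t -> bounded_operator (UU t tau),
      forall t s tau x, 0 <= tau -> tau <= s -> s <= t ->
        UU t tau x = UU t s (UU s tau x),
      forall t x, 0 <= t -> UU t t x = x &
      forall x, {within [set q : R * R | 0 <= q.2 <= q.1],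
        continuous (fun q : R * R => UU q.1 q.2 x)}].

Definition exponential_bound UU (M omega : R) : Prop :=
  forall t tau, 0 <= tau <= t ->
    opnorm_le (UU t tau) (M * expR (omega * (t - tau))).

Definition exponentially_bounded UU : Prop :=
  exists M omega, 1 <= M /\ exponential_bound UU M omega.

Definition exponentially_stable UU : Prop :=
  exists M omega, [/\ 1 <= M, omega < 0 & exponential_bound UU M omega].

Definition Gop UU (f : R -> X) : R -> X := fun t =>
  bochner_integral mu `[0, t] (fun tau => UU t tau (f tau)).

End EvolutionFamilies.

Definition multiplication_op {V W : normedModType R[i]} (D : R -> V -> W)
  (u : R -> V) : R -> W := fun t => D t (u t).

Section Systems.
Context {X U Y : normedModType R[i]}.

Definition stabilizable (UU : R -> R -> X -> X) (B : R -> U -> X) : Prop :=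
  exists (F : R -> X -> U) (UBF : R -> R -> X -> X),
    [/\ Linfty_strong F, evolution_family UBF, exponentially_stable UBF &
        forall t s x, 0 <= s <= t ->
          UBF t s x = UU t s x +
            bochner_integral mu `[s, t]
              (fun tau => UU t tau (B tau (F tau (UBF tau s x))))].

Definition detectable (UU : R -> R -> X -> X) (C : R -> X -> Y) : Prop :=
  exists (K : R -> Y -> X) (UKC : R -> R -> X -> X),
    [/\ Linfty_strong K, evolution_family UKC, exponentially_stable UKC &
        forall t s x, 0 <= s <= t ->
          UKC t s x = UU t s x +
            bochner_integral mu `[s, t]
              (fun tau => UKC t tau (K tau (C tau (UU tau s x))))].

End Systems.
End HalfLine.

(* Main.v *)
(* That stability implies the other statements is Young's inequality for the
   convolution with a decaying exponential. Conversely, by Datko's argument it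
   suffices to bound the L^p norm of every trajectory t |-> U(t,s)x by a multiple
   of |x|, uniformly in s.
   If G is bounded, apply it to f = 1_[s,s+1] U(.,s)x: (Gf)(t) = U(t,s)x for
   t >= s+1. If the system is stabilizable, the feedback identity reads
   U(.,s)x = U_BF(.,s)x - G B u with u = F U_BF(.,s)x in L^p. If it is detectable,
   U(.,s)x = U_KC(.,s)x - G_KC K y where y = C U(.,s)x, and G_KC is bounded by
   Young's inequality; y is in L^p because it agrees with C G f for t >= s+1 in
   (iv), and because y = C U_BF(.,s)x - L u in (v). In particular the Bochner
   integral is never exchanged with another one. *)

Require Import Defs.
From mathcomp Require Import all_boot all_order all_algebra.
From mathcomp Require Import all_classical all_reals all_analysis.
From mathcomp Require Import measurable_realfun complex.
From mathcomp Require Import ring lra.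
Import Order.TTheory GRing.Theory Num.Theory.
Import numFieldNormedType.Exports.

Set Implicit Arguments.
Unset Strict Implicit.
Unset Printing Implicit Defensive.

Local Open Scope classical_set_scope.
Local Open Scope ring_scope.
Local Open Scope complex_scope.

(** * The real-valued norm *)

(** The delicate point is measurability rather than the estimates. Strong measurability only gives
    an almost everywhere limit of simple functions, so the norm of such a function need not be
    measurable. Integrals are therefore computed on representatives that are [strong], a condition
    preserved by limits and countable gluing. Mapping L^p into L^p includes strong measurability of
    [Gop UU f], for which both the interval and the integrand move with t; it follows from right
    continuity, which dominated convergence yields. Bounds are stated for [pow_integral], the p-th
    power of the norm: constants then multiply under composition, and a crude factor 2^p replaces
    Minkowski's inequality. Inputs extended by 0 before time s turn the integrals over [s,t] in the
    feedback identities into values of the Green operator on the half-line. For detectability the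
    order matters: the output y enters the identity as an input of G_KC, so y has to be bounded in
    L^p before the identity can be exploited. *)

Section Rnorm.
Context {R : realType} {V : normedModType R[i]}.
Implicit Types (x y : V).

Lemma rnormE x : `|x| = (rnorm x)%:C.
Proof.
by rewrite /rnorm RRe_real// ger0_real.
Qed.

Lemma rnorm_ge0 x : 0 <= rnorm x.
Proof. by rewrite -lecR -rnormE normr_ge0. Qed.

Lemma rnorm0 : rnorm (0 : V) = 0.
Proof. by rewrite /rnorm normr0. Qed.

Lemma rnorm0_eq0 x : rnorm x = 0 -> x = 0.
Proof. by move=> x0; apply/normr0_eq0; rewrite rnormE x0. Qed.

Lemma rnormN x : rnorm (- x) = rnorm x.
Proof. by rewrite /rnorm normrN. Qed.

Lemma rnormB_sym x y : rnorm (x - y) = rnorm (y - x).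
Proof. by rewrite -rnormN opprB. Qed.

Lemma rnormD x y : rnorm (x + y) <= rnorm x + rnorm y.
Proof. by rewrite -lecR rmorphD/= -!rnormE ler_normD. Qed.

Lemma rnormB x y : rnorm (x - y) <= rnorm x + rnorm y.
Proof. by rewrite -(rnormN y) rnormD. Qed.

Lemma rnorm_triangle z x y : rnorm (x - y) <= rnorm (x - z) + rnorm (z - y).
Proof. by rewrite -[x - y](subrKA z) rnormD. Qed.

Lemma rnormZ (a : R[i]) x : rnorm (a *: x) = complex.Re `|a| * rnorm x.
Proof.
by rewrite /rnorm normrZ (rnormE x) normc_def/= mul0r subr0.
Qed.

Lemma rnormZR (a : R) x : 0 <= a -> rnorm (a%:C *: x) = a * rnorm x.
Proof. by move=> a0; rewrite rnormZ ger0_norm ?ler0c. Qed.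

Lemma rnorm_dist x y : `|rnorm x - rnorm y| <= rnorm (x - y).
Proof.
rewrite ler_norml; apply/andP; split.
  by rewrite lerNl opprB lerBlDr rnormB_sym -{1}(subrK x y) rnormD.
by rewrite lerBlDr -{1}(subrK y x) rnormD.
Qed.

Lemma cvg_rnormP (T : Type) (F : set_system T) (FF : Filter F) (f : T -> V) (l : V) :
  f t @[t --> F] --> l <-> rnorm (f t - l) @[t --> F] --> 0.
Proof.
split=> [/cvgrPdist_lt fl|/cvgrPdist_lt fl].
  apply/cvgrPdist_lt => e e0; have := fl e%:C; rewrite ltcR => /(_ e0).
  apply: filterS => t; rewrite sub0r normrN ger0_norm ?rnorm_ge0//.
  by rewrite rnormE ltcR rnormB_sym.
(* A positive element of [R[i]] has zero imaginary part, so the complex tolerance reduces to the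
   real number [e1]. *)
apply/cvgrPdist_lt => -[e1 e2]; rewrite ltcE/= => /andP[/eqP-> e0].
have := fl e1 e0; apply: filterS => t.
rewrite sub0r normrN ger0_norm ?rnorm_ge0// rnormE ltcE/= eqxx/=.
by rewrite rnormB_sym.
Qed.

Lemma cvg_rnorm (T : Type) (F : set_system T) (FF : Filter F) (f : T -> V) (l : V) :
  f t @[t --> F] --> l -> rnorm (f t) @[t --> F] --> rnorm l.
Proof.
move=> /cvg_rnormP/cvgrPdist_lt fl; apply/cvgrPdist_lt => e e0.
have := fl e e0; apply: filterS => t.
rewrite sub0r normrN ger0_norm ?rnorm_ge0// => h.
by rewrite distrC (le_lt_trans _ h)// rnorm_dist.
Qed.

End Rnorm.

(** * Strong measurability *)

Section Strong.
Context d (T : measurableType d) {R : realType} {V : normedModType R[i]}.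
Implicit Types (f g : T -> V) (k : T -> nat).

(** No sigma-algebra is put on [V]. A countably valued function is written [q \o k] with [k] of this
    kind, so that measurability only concerns the index map. *)
Definition nat_measurable k := forall j, measurable (k @^-1` [set j]).

(* By [strong_approx], this amounts to being a pointwise limit of simple
   functions; unlike that condition, it is visibly stable under limits. *)
Definition strong f :=
  (exists q : nat -> V, forall t e, 0 < e -> exists j, rnorm (f t - q j) < e) /\
  forall v, measurable_fun setT (fun t => rnorm (f t - v)).

Lemma strong_rnorm f : strong f -> measurable_fun setT (fun t => rnorm (f t)).
Proof. by case=> _ /(_ 0); under eq_fun do rewrite subr0. Qed.

Lemma strong_cst v : strong (cst v : T -> V).
Proof.
split; last by move=> w; exact: (measurable_cst (rnorm (v - w))).
by exists (cst v) => t e e0; exists 0%N; rewrite subrr rnorm0.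
Qed.

Lemma strong_lim (f_ : nat -> T -> V) f : (forall n, strong (f_ n)) ->
  (forall t, f_ n t @[n --> \oo] --> f t) -> strong f.
Proof.
move=> sf fl; split; last first.
  move=> v; apply: (@measurable_fun_cvg _ _ _ setT
    (fun n t => rnorm (f_ n t - v))) => [n|t _].
    by have [_] := sf n; exact.
  by apply: cvg_rnorm; apply: cvgB; [exact: fl|exact: cvg_cst].
have /choice[q qP] : forall n, exists q : nat -> V,
    forall t e, 0 < e -> exists j, rnorm (f_ n t - q j) < e.
  by move=> n; case: (sf n).
(* A single sequence enumerates all approximants [q n j], the pair [(n, j)] being coded by one
   index. *)
exists (fun m => if (unpickle m : option (nat * nat)) is Some (n, j) then q n j else 0).
move=> t e e0; have e20 : 0 < e / 2 by rewrite divr_gt0.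
have /cvg_rnormP/cvgrPdist_lt/(_ _ e20)[n _ /(_ n (leqnn n))] := fl t.
rewrite /= sub0r normrN ger0_norm ?rnorm_ge0// => h.
have [j hj] := qP n t _ e20.
exists (pickle (n, j)); rewrite pickleK (le_lt_trans (rnorm_triangle (f_ n t) _ _))//.
by rewrite (splitr e) ltrD// rnormB_sym.
Qed.

(** The domain splits into the countably many measurable pieces [k t = j], on each of which [g_ j]
    is used. Constant [g_ j] give the countably valued functions, and two pieces give
    [strong_if]. *)
Lemma strong_glue (g_ : nat -> T -> V) k : nat_measurable k ->
  (forall j, strong (g_ j)) -> strong (fun t => g_ (k t) t).
Proof.
move=> mk sg; split; last first.
  move=> v _ A mA; rewrite setTI.
  rewrite (_ : _ @^-1` _ = \bigcup_j (k @^-1` [set j] `&`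
      (fun t => rnorm (g_ j t - v)) @^-1` A)).
    apply: bigcup_measurable => j _; apply: measurableI; first exact: mk.
    by rewrite -[X in measurable X]setTI; case: (sg j) => _ /(_ v); exact.
  by apply/seteqP; split=> t /=; [exists (k t)|case=> j _ [<-]].
have /choice[q qP] : forall n, exists q : nat -> V,
    forall t e, 0 < e -> exists j, rnorm (g_ n t - q j) < e.
  by move=> n; case: (sg n).
exists (fun m => if (unpickle m : option (nat * nat)) is Some (n, j) then q n j else 0).
move=> t e e0; have [j hj] := qP (k t) t e e0.
by exists (pickle (k t, j)); rewrite pickleK.
Qed.

Lemma nat_measurable_cst j : nat_measurable (cst j).
Proof. by move=> i; rewrite preimage_cst; case: ifP. Qed.

Lemma nat_measurable_if (A : set T) k k' : measurable A ->
  nat_measurable k -> nat_measurable k' ->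
  nat_measurable (fun t => if t \in A then k t else k' t).
Proof.
move=> mA mk mk' j; rewrite (_ : _ @^-1` _ =
  (A `&` k @^-1` [set j]) `|` (~` A `&` k' @^-1` [set j])).
  apply: measurableU; apply: measurableI => //; last exact: measurableC.
apply/seteqP; split=> t /=.
  by case: (boolP (t \in A)) => [/set_mem|/negP]; rewrite ?inE; [left|right].
by case=> -[+ <-] => [/mem_set ->|nAt] //; rewrite (@memNset _ A t).
Qed.

Lemma strong_if (A : set T) f g : measurable A -> strong f -> strong g ->
  strong (fun t => if t \in A then f t else g t).
Proof.
move=> mA sf sg.
rewrite (_ : (fun t => _) = fun t =>
    (fun j => if j is 0%N then g else f) (if t \in A then 1%N else 0%N) t); last first.
  by apply/funext => t; case: (t \in A).
apply: (@strong_glue (fun j => if j is 0%N then g else f)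
  (fun t => if t \in A then 1%N else 0%N)); last by case.
by apply: nat_measurable_if => //; exact: nat_measurable_cst.
Qed.

(* [f \_ A] is avoided for vector-valued [f]: it uses the [point] of the normed
   space, which is unspecified and need not be [0]. *)
Lemma strong_patch (A : set T) f : measurable A -> strong f -> strong (patch (fun=> 0) A f).
Proof. by move=> mA sf; apply: strong_if => //; exact: strong_cst. Qed.

Lemma strong_approx f : strong f -> exists (q : nat -> V) (k : nat -> T -> nat),
  [/\ forall m, nat_measurable (k m), forall m t, (k m t <= m)%N,
      forall m t, rnorm (f t - q (k m t)) <= rnorm (f t) &
      forall t, q (k m t) @[m --> \oo] --> f t].
Proof.
(* Putting 0 in front of the sequence keeps the approximation error below [rnorm (f t)], which later
   serves as the majorant in dominated convergence. *)
move=> [[q0 q0P] mf]; pose q j := if j is j.+1 then q0 j else 0.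
(* [k m t] is the index of a point nearest to [f t] among [q 0], ..., [q m]; a new point replaces
   the old one only if it is strictly closer. *)
pose k := fix k m t := if m is m'.+1 then
   if rnorm (f t - q m) < rnorm (f t - q (k m' t)) then m else k m' t else 0%N.
have kS m t : k m.+1 t = if rnorm (f t - q m.+1) < rnorm (f t - q (k m t))
   then m.+1 else k m t by [].
have k_best m t j : (j <= m)%N -> rnorm (f t - q (k m t)) <= rnorm (f t - q j).
  elim: m => [|m IH]; first by rewrite leqn0 => /eqP ->.
  rewrite leq_eqVlt ltnS kS; case: ltP => h /predU1P[->//|jm //].
    by rewrite (le_trans (ltW h))// IH.
  exact: IH.
have mk m : measurable_fun setT (fun t => rnorm (f t - q (k m t))) /\
    nat_measurable (k m).
  elim: m => [|m [IH1 IH2]]; first by split; [exact: mf|exact: nat_measurable_cst].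
  pose A := [set t | rnorm (f t - q m.+1) < rnorm (f t - q (k m t))].
  have mA : measurable A.
    have := measurable_fun_ltr (mf (q m.+1)) IH1.
    by move=> /(_ measurableT [set true] I); rewrite setTI.
  split.
    rewrite (_ : (fun t => _) = fun t =>
      Num.min (rnorm (f t - q m.+1)) (rnorm (f t - q (k m t)))).
      exact: measurable_minr.
    by apply/funext => t; rewrite kS minEle; case: ltgtP.
  rewrite (_ : k m.+1 = fun t => if t \in A then m.+1 else k m t).
    by apply: nat_measurable_if => //; exact: nat_measurable_cst.
  apply/funext => t; rewrite kS; congr (if _ then _ else _).
  by apply/idP/idP; rewrite inE.
exists q, k; split.
- by move=> m; case: (mk m).
- by elim=> // m IH t; rewrite kS; case: ifP => // _; rewrite leqW.
- by move=> m t; rewrite (le_trans (k_best m t 0%N _))// subr0.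
- move=> t; apply/cvg_rnormP/cvgrPdist_lt => e e0.
  have [j hj] := q0P t e e0; exists j.+1 => // m /= jm.
  rewrite sub0r normrN ger0_norm ?rnorm_ge0// rnormB_sym.
  exact: le_lt_trans (k_best _ _ _ jm) hj.
Qed.

Lemma simple_function_strong s : simple_function s -> strong s.
Proof.
move=> [/finite_seqP[r rE] ms].
have s_in t : s t \in r by have : range s (s t) by []; rewrite rE.
split.
  exists (nth 0 r) => t e e0; exists (index (s t) r).
  by rewrite nth_index// subrr rnorm0.
move=> v _ A mA; rewrite setTI (_ : _ @^-1` _ =
  \bigcup_(w in [set` r] `&` [set w | A (rnorm (w - v))]) s @^-1` [set w]).
  apply: fin_bigcup_measurable => [|w _]; last exact: ms.
  exact: finite_setIl.
by apply/seteqP; split=> t /=; [move=> As; exists (s t) => //; split=> //; exact: s_in|case=> w [_ Aw] ->].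
Qed.

Lemma simple_function_nat (q : nat -> V) k m : nat_measurable k ->
  (forall t, (k t <= m)%N) -> simple_function (q \o k).
Proof.
move=> mk km; split.
  apply: (@sub_finite_set _ _ (q @` `I_m.+1)).
    by move=> _ [t _ <-]; exists (k t) => //=; rewrite ltnS.
  exact/finite_image/finite_II.
move=> v; rewrite (_ : _ @^-1` _ = \bigcup_(j in [set j | q j = v]) (k @^-1` [set j])).
  by apply: bigcup_measurable => i _; exact: mk.
by apply/seteqP; split=> t /=; [exists (k t)|case=> i /= <- ->].
Qed.

End Strong.

Section StronglyMeasurable.
Context d (T : measurableType d) {R : realType} (mu : {measure set T -> \bar R}).
Context {V : normedModType R[i]}.
Variables (E : set T) (mE : measurable E).
Implicit Types (f g : T -> V).

Lemma strongly_measurableP f : strongly_measurable mu E f <->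
  exists f' N, [/\ strong f', measurable N, mu N = 0%E &
    forall t, E t -> ~ N t -> f t = f' t].
Proof.
split=> [[s_ [ss [N [mN N0 sN]]]]|[f' [N [sf mN N0 ff']]]].
  have mEN : measurable (E `\` N) by exact: measurableD.
  exists (patch (fun=> 0) (E `\` N) f), N; split=> //.
    apply: (@strong_lim _ _ _ _ (fun n => patch (fun=> 0) (E `\` N) (s_ n))).
      by move=> n; apply: strong_patch => //; exact: simple_function_strong.
    move=> t; rewrite /patch; case: ifPn => [/set_mem[Et Nt]|_]; last exact: cvg_cst.
    by apply: contrapT => h; apply: Nt; apply: sN => /= /(_ Et).
  by move=> t Et Nt; rewrite /patch mem_set.
have [q [k [mk km _ kf]]] := strong_approx sf.
exists (fun m => q \o k m); split; first by move=> m; exact: (simple_function_nat _ (mk m) (km m)).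
exists N; split=> // t /=; apply: contra_notP => Nt Et.
by rewrite ff'; first exact: kf.
Qed.

Lemma strong_strongly_measurable f : strong f -> strongly_measurable mu E f.
Proof.
by move=> sf; apply/strongly_measurableP; exists f, set0; split=> //; rewrite measure0.
Qed.

(** With the defining simple functions this would call for a diagonal argument. Collecting all
    exceptional sets in one null set [M] reduces it to [strong_lim] for the representatives. *)
Lemma strongly_measurable_lim (f_ : nat -> T -> V) f :
  (forall n, strongly_measurable mu E (f_ n)) ->
  {ae mu, forall t, E t -> f_ n t @[n --> \oo] --> f t} ->
  strongly_measurable mu E f.
Proof.
move=> sf [N [mN N0 fN]].
have /choice[g_ gP] n := (strongly_measurableP (f_ n)).1 (sf n).
have {gP} /choice[N_ NP] := gP.
pose M := N `|` \bigcup_n N_ n.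
have mM : measurable M.
  by apply: measurableU => //; apply: bigcup_measurable => n _; case: (NP n).
apply/strongly_measurableP; exists (patch (fun=> 0) (E `\` M) f), M; split=> //.
- apply: (@strong_lim _ _ _ _ (fun n => patch (fun=> 0) (E `\` M) (g_ n))).
    by move=> n; apply: strong_patch; [exact: measurableD|case: (NP n)].
  move=> t; rewrite /patch; case: ifPn => [/set_mem[Et Mt]|_]; last exact: cvg_cst.
  rewrite (_ : (fun n => g_ n t) = (fun n => f_ n t)).
    by apply: contrapT => h; apply: Mt; left; apply: fN => /= /(_ Et).
  apply/funext => n; case: (NP n) => _ _ _ -> // Nt.
  by apply: Mt; right; exists n.
- apply: measure_negligible => //; apply: negligibleU; first by exists N; split.
  by apply: negligible_bigcup => n; case: (NP n) => _ mNn Nn0 _; exists (N_ n); split.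
- by move=> t Et Mt; rewrite /patch mem_set.
Qed.

Lemma strongly_measurable_glue (g_ : nat -> T -> V) k : nat_measurable k ->
  (forall j, strongly_measurable mu E (g_ j)) ->
  strongly_measurable mu E (fun t => g_ (k t) t).
Proof.
move=> mk sg.
have /choice[g gP] n := (strongly_measurableP (g_ n)).1 (sg n).
have {gP} /choice[N NP] := gP.
have mM : measurable (\bigcup_n N n).
  by apply: bigcup_measurable => n _; case: (NP n).
apply/strongly_measurableP; exists (fun t => g (k t) t), (\bigcup_n N n); split=> //.
- by apply: strong_glue => // j; case: (NP j).
- apply: measure_negligible => //; apply: negligible_bigcup => n.
  by case: (NP n) => _ mNn Nn0 _; exists (N n); split.
- move=> t Et Nt; case: (NP (k t)) => _ _ _; apply=> // Nkt.
  by apply: Nt; exists (k t).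
Qed.

Lemma strongly_measurable_ext f g : (forall t, E t -> f t = g t) ->
  strongly_measurable mu E f -> strongly_measurable mu E g.
Proof.
move=> fg [s_ [ss fs]]; exists s_; split=> //.
by apply: filterS fs => t h Et; rewrite -fg//; exact: h.
Qed.

End StronglyMeasurable.

(** Measurability of [D] is known only on fixed vectors. For a countably valued approximation of [f]
    the product is a gluing of the functions [D t (q j)]; continuity of each single [D t] then gives
    the limit, without any bound uniform in [t]. *)
Lemma strongly_measurable_mul d (T : measurableType d) {R : realType}
    (mu : {measure set T -> \bar R}) (V W : normedModType R[i]) (E : set T)
    (D : T -> V -> W) (f : T -> V) : measurable E ->
  (forall v, strongly_measurable mu E (fun t => D t v)) ->
  (forall t, E t -> bounded_operator (D t)) ->
  strongly_measurable mu E f -> strongly_measurable mu E (fun t => D t (f t)).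
Proof.
move=> mE sD bD /(strongly_measurableP mu mE)[f' [N [sf mN N0 ff']]].
have [q [k [mk _ _ kf]]] := strong_approx sf.
apply: (@strongly_measurable_lim _ _ _ _ _ _ mE (fun m t => D t (q (k m t)))).
  move=> m; exact: (@strongly_measurable_glue _ _ _ _ _ _ mE (fun j t => D t (q j))).
exists N; split=> // t /=; apply: contra_notP => Nt Et; rewrite (ff' _ Et Nt).
have [linD [c Dc]] := bD _ Et.
have DB x y : D t (x - y) = D t x - D t y.
  by rewrite -scaleN1r addrC linD scaleN1r addrC.
apply/cvg_rnormP.
apply: (@squeeze_cvgr _ _ _ _ (cst 0) (fun m => c * rnorm (q (k m t) - f' t))).
- by near=> m; rewrite rnorm_ge0 -DB Dc.
- exact: cvg_cst.
- rewrite -[X in _ --> X](mulr0 c); apply: cvgM; first exact: cvg_cst.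
  by apply/cvg_rnormP; exact: kf.
Unshelve. all: by end_near. Qed.

(** * Integrals of nonmeasurable functions *)

Section LowerIntegral.
Context d (T : measurableType d) {R : realType} (mu : {measure set T -> \bar R}).
Implicit Types (D : set T) (f g : T -> \bar R).
Local Open Scope ereal_scope.

Import HBNNSimple.

(* Strongly measurable functions are only almost everywhere equal to Borel ones,
   so their norms need not be measurable. The integral of a nonnegative
   nonmeasurable function is a lower integral, which is still monotone. *)
Lemma ge0_le_lower_integral D f g : (forall t, D t -> 0 <= f t) ->
  (forall t, D t -> f t <= g t) ->
  \int[mu]_(t in D) f t <= \int[mu]_(t in D) g t.
Proof.
move=> f0 fg; rewrite [leLHS]integral_mkcond [leRHS]integral_mkcond.
have fg' t : (f \_ D) t <= (g \_ D) t.
  by rewrite !patchE; case: ifPn => // /set_mem; exact: fg.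
have f0' t : 0 <= (f \_ D) t.
  by rewrite patchE; case: ifPn => // /set_mem; exact: f0.
rewrite !ge0_integralTE//; last by move=> t; exact: le_trans (fg' t).
apply: ereal_sup_le => _ [h /= hf <-]; exists h => //.
by move=> t; exact: le_trans (fg' t).
Qed.

(** The left side is a supremum over simple functions [h] below [f]. Each [h] is measurable, so
    removing [N] leaves its integral unchanged, and off [N] it lies below [g]. *)
Lemma ae_ge0_le_lower_integral D N f g : measurable D -> measurable N -> mu N = 0 ->
  (forall t, D t -> 0 <= f t) -> (forall t, D t -> 0 <= g t) ->
  (forall t, D t -> ~ N t -> f t <= g t) ->
  \int[mu]_(t in D) f t <= \int[mu]_(t in D) g t.
Proof.
move=> mD mN N0 f0 g0 fg; rewrite [leLHS]integral_mkcond ge0_integralTE; last first.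
  by move=> t; rewrite patchE; case: ifPn => // /set_mem; exact: f0.
apply: ge_ereal_sup => _ [h /= hf <-].
rewrite -integralT_nnsfun (ge0_negligible_integral mN)//; last 2 first.
- exact/measurable_EFinP.
- by move=> t _; rewrite lee_fin.
rewrite [leLHS]integral_mkcond [leRHS]integral_mkcond.
apply: ge0_le_lower_integral => t _; rewrite !patchE.
  by case: ifPn => // _; rewrite lee_fin.
case: ifPn => [/set_mem[_ Nt]|_]; last by case: ifPn => // /set_mem; exact: g0.
have := hf t; rewrite patchE; case: ifPn => // /set_mem Dt ht.
exact/(le_trans ht)/fg.
Qed.

Lemma ae_ge0_eq_lower_integral D N f g : measurable D -> measurable N -> mu N = 0 ->
  (forall t, D t -> 0 <= f t) -> (forall t, D t -> 0 <= g t) ->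
  (forall t, D t -> ~ N t -> f t = g t) ->
  \int[mu]_(t in D) f t = \int[mu]_(t in D) g t.
Proof.
move=> mD mN N0 f0 g0 fg; apply/le_anti/andP; split.
  by apply: (ae_ge0_le_lower_integral mD mN) => // t Dt Nt; rewrite fg.
by apply: (ae_ge0_le_lower_integral mD mN) => // t Dt Nt; rewrite fg.
Qed.

End LowerIntegral.

Section StrongOperations.
Context d (T : measurableType d) {R : realType} {V : normedModType R[i]}.
Implicit Types (f g s : T -> V).

Lemma strongDr f v : strong f -> strong (fun t => f t + v).
Proof.
move=> [[q qP] mf]; split.
  exists (fun j => q j + v) => t e /(qP t)[j h]; exists j.
  by rewrite opprD addrACA subrr addr0.
move=> w; rewrite (_ : (fun t => _) = fun t => rnorm (f t - (w - v))); first exact: mf.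
by apply/funext => t; rewrite opprB addrA.
Qed.

(** Approximating one summand is enough: with [f] replaced by [q (k m t)] the sum is a gluing of
    translates of [g]. *)
Lemma strong_scaleD (a : R[i]) f g : strong f -> strong g ->
  strong (fun t => a *: f t + g t).
Proof.
move=> /strong_approx[q [k [mk _ _ kf]]] sg.
apply: (@strong_lim _ _ _ _ (fun m t => a *: q (k m t) + g t)).
  move=> m; apply: (@strong_glue _ _ _ _ (fun j t => a *: q j + g t)) => // j.
  by under eq_fun do rewrite addrC; exact: strongDr.
move=> t; apply: cvgD; last exact: cvg_cst.
by apply: cvgZ; [exact: cvg_cst|exact: kf].
Qed.

End StrongOperations.

Section SmOperations.
Context d (T : measurableType d) {R : realType} (mu : {measure set T -> \bar R}).
Context {V : normedModType R[i]}.
Variables (E : set T) (mE : measurable E).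
Implicit Types (f g : T -> V).

Lemma strongly_measurable_scaleD (a : R[i]) f g :
  strongly_measurable mu E f -> strongly_measurable mu E g ->
  strongly_measurable mu E (fun t => a *: f t + g t).
Proof.
move=> /(strongly_measurableP mu mE)[f' [N [sf mN N0 ff']]].
move=> /(strongly_measurableP mu mE)[g' [M [sg mM M0 gg']]].
apply/(strongly_measurableP mu mE).
exists (fun t => a *: f' t + g' t), (N `|` M); split.
- exact: strong_scaleD.
- exact: measurableU.
- by rewrite measureU0.
- by move=> t Et /not_orP[Nt Mt]; rewrite ff'// gg'.
Qed.

Lemma strongly_measurableB f g :
  strongly_measurable mu E f -> strongly_measurable mu E g ->
  strongly_measurable mu E (fun t => f t - g t).
Proof.
move=> sf sg; have := strongly_measurable_scaleD (-1) sg sf.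
by apply: strongly_measurable_ext => t _; rewrite scaleN1r addrC.
Qed.

Lemma strongly_measurable_subset (E' : set T) f : E' `<=` E ->
  strongly_measurable mu E f -> strongly_measurable mu E' f.
Proof.
move=> sE [s_ [ss fs]]; exists s_; split=> //.
by apply: filterS fs => t h /sE.
Qed.

Lemma strongly_measurable_patch (E' : set T) f : measurable E' ->
  strongly_measurable mu E' f -> strongly_measurable mu E (patch (fun=> 0) E' f).
Proof.
move=> mE' /(strongly_measurableP mu mE')[f' [N [sf mN N0 ff']]].
apply/(strongly_measurableP mu mE).
exists (patch (fun=> 0) E' f'), N; split => //; first exact: strong_patch.
by move=> t Et Nt; rewrite /patch; case: ifPn => // /set_mem E't; exact: ff'.
Qed.

(** Lower integrals are not subadditive in general, so additivity is applied to the measurable norms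
    of representatives of [f] and [g]; on the side of [h] monotonicity suffices. *)
Lemma le_integral_rnormD (f g h : T -> V) (a b : R) : 0 <= a -> 0 <= b ->
  strongly_measurable mu E f -> strongly_measurable mu E g ->
  {ae mu, forall t, E t -> rnorm (h t) <= a * rnorm (f t) + b * rnorm (g t)} ->
  (\int[mu]_(t in E) (rnorm (h t))%:E <=
    a%:E * (\int[mu]_(t in E) (rnorm (f t))%:E) +
    b%:E * (\int[mu]_(t in E) (rnorm (g t))%:E))%E.
Proof.
move=> a0 b0 /(strongly_measurableP mu mE)[f' [N [sf mN N0 ff']]].
move=> /(strongly_measurableP mu mE)[g' [M [sg mM M0 gg']]] [P [mP P0 hP]].
rewrite (ae_ge0_eq_lower_integral (f := fun t => (rnorm (f t))%:E)
  (g := fun t => (rnorm (f' t))%:E) mE mN N0); last 3 first.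
- by move=> t _; rewrite lee_fin rnorm_ge0.
- by move=> t _; rewrite lee_fin rnorm_ge0.
- by move=> t Et Nt; rewrite ff'.
rewrite (ae_ge0_eq_lower_integral (f := fun t => (rnorm (g t))%:E)
  (g := fun t => (rnorm (g' t))%:E) mE mM M0); last 3 first.
- by move=> t _; rewrite lee_fin rnorm_ge0.
- by move=> t _; rewrite lee_fin rnorm_ge0.
- by move=> t Et Nt; rewrite gg'.
have mr (u : T -> V) : strong u -> measurable_fun E (fun t => (rnorm (u t))%:E).
  by move=> /strong_rnorm su; apply/measurable_EFinP; exact: measurable_funTS.
rewrite -!ge0_integralZl_EFin//; do ?[exact: mr]; do ?[by move=> t _; rewrite lee_fin rnorm_ge0].
rewrite -ge0_integralD//; last 4 first.
- by move=> t _; rewrite -EFinM lee_fin mulr_ge0// rnorm_ge0.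
- by apply: measurable_funeM; exact: mr.
- by move=> t _; rewrite -EFinM lee_fin mulr_ge0// rnorm_ge0.
- by apply: measurable_funeM; exact: mr.
have mNMP : measurable (N `|` M `|` P) by do 2 apply: measurableU => //.
apply: (ae_ge0_le_lower_integral mE mNMP).
- by rewrite !measureU0//; exact: measurableU.
- by move=> t _; rewrite lee_fin rnorm_ge0.
- by move=> t _; rewrite -!EFinM -EFinD lee_fin addr_ge0// mulr_ge0// rnorm_ge0.
- move=> t Et /not_orP[/not_orP[Nt Mt] Pt].
  rewrite -!EFinM -EFinD lee_fin -ff'// -gg'//.
  by apply: contrapT => h0; apply: Pt; apply: hP => /= /(_ Et).
Qed.

End SmOperations.

(** * The Bochner integral *)

Section SimpleIntegral.
Context d (T : measurableType d) {R : realType} (mu : {measure set T -> \bar R}).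
Context {V : normedModType R[i]}.
Variables (E : set T) (mE : measurable E) (Efin : (mu E < +oo)%E).
Implicit Types (s : T -> V).

Lemma finite_measure_sub (A : set T) : measurable A -> mu (E `&` A) \is a fin_num.
Proof.
move=> mA; rewrite ge0_fin_numE// (le_lt_trans _ Efin)//.
by apply: le_measure; rewrite ?inE//; exact: measurableI.
Qed.

(** The integral may be computed over a partition finer than the fibres of the function. With the
    pair of two simple functions as [r], their integrals and that of a combination become sums over
    one index set, and linearity is immediate. *)
Lemma simple_integral_comp (W : choiceType) (r : T -> W) (phi : W -> V) :
  finite_set (range r) -> (forall w, measurable (r @^-1` [set w])) ->
  simple_integral mu E (phi \o r) =
  \sum_(w \in range r) (fine (mu (E `&` r @^-1` [set w])))%:C *: phi w.
Proof.
move=> fr mr; pose m w := fine (mu (E `&` r @^-1` [set w])).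
have frphi : finite_set (range (phi \o r)) 
  by apply: sub_finite_set (finite_image phi fr) => _ [t _ <-]; exists (r t) => //; exists t.
rewrite /simple_integral.
(* Each fibre of [phi \o r] splits into fibres of [r]; as [E] has finite measure, [fine] is additive
   over this splitting. *)
transitivity (\sum_(v \in range (phi \o r)) \sum_(w \in range r)
    (if phi w == v then (m w)%:C *: v else 0)).
  apply: eq_fsbigr => v _.
  have fA : finite_set (range r `&` [set w | phi w = v]) by apply: finite_setIl.
  rewrite (_ : E `&` _ = \bigcup_(w in range r `&` [set w | phi w = v])
      (E `&` r @^-1` [set w])); last first.
    apply/seteqP; split=> t /=.
      by move=> [Et rt]; exists (r t) => //; split=> //=; exists t.
    by case=> w [_ /= <-] [Et ->].
  rewrite measure_fin_bigcup//; last 2 first.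
  - by move=> w1 w2 _ _ [t [[_ /= <-] [_ /= <-]]].
  - by move=> w _; exact: measurableI.
  rewrite fsbig_finite//= -sum_fine; last by move=> w _; exact: finite_measure_sub.
  rewrite -/(m _) rmorph_sum scaler_suml.
  transitivity (\sum_(w \in range r `&` [set w | phi w = v]) (m w)%:C *: v).
    by rewrite fsbig_finite.
  rewrite fsbig_mkcondr; apply: eq_fsbigr => w _.
  by congr (if _ then _ else _); apply/idP/eqP; rewrite inE.
rewrite exchange_fsbig//; apply: eq_fsbigr => w /set_mem[t _ <-].
rewrite (fsbigD1 (phi (r t)))//=; last by exists t.
rewrite eqxx fsbig1 ?addr0// => v [_ /= /eqP].
by rewrite eq_sym => /negPf ->.
Qed.

Lemma simple_function_comp (W : choiceType) (r : T -> W) (phi : W -> V) :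
  finite_set (range r) -> (forall w, measurable (r @^-1` [set w])) ->
  simple_function (phi \o r).
Proof.
move=> fr mr; split; first 
  by apply: sub_finite_set (finite_image phi fr) => _ [t _ <-]; exists (r t) => //; exists t.
move=> v; rewrite (_ : _ @^-1` _ =
    \bigcup_(w in range r `&` [set w | phi w = v]) (r @^-1` [set w])); last first.
  apply/seteqP; split=> t /=.
    by move=> rt; exists (r t) => //; split=> //=; exists t.
  by case=> w [_ /= <-] ->.
apply: fin_bigcup_measurable => [|w _]; last exact: mr.
exact: finite_setIl.
Qed.

Section Pair.
Variables (s s' : T -> V) (ss : simple_function s) (ss' : simple_function s').

Let fpair : finite_set (range (fun t => (s t, s' t))).
Proof.
case: ss ss' => fs _ [fs' _]; apply: sub_finite_set (finite_setX fs fs').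
by move=> _ [t _ <-]; split; exists t.
Qed.

Let mpair w : measurable ((fun t => (s t, s' t)) @^-1` [set w]).
Proof.
case: ss ss' w => _ ms [_ ms'] [v v'].
rewrite (_ : _ @^-1` _ = s @^-1` [set v] `&` s' @^-1` [set v']).
  exact: measurableI.
by apply/seteqP; split=> t /= [-> ->].
Qed.

Lemma simple_function_scaleD a : simple_function (fun t => a *: s t + s' t).
Proof. exact: (simple_function_comp (fun w : V * V => a *: w.1 + w.2) fpair mpair). Qed.

Lemma simple_integral_scaleD a : simple_integral mu E (fun t => a *: s t + s' t) =
  a *: simple_integral mu E s + simple_integral mu E s'.
Proof.
rewrite (simple_integral_comp (fun w : V * V => a *: w.1 + w.2) fpair mpair).
rewrite (simple_integral_comp (@fst V V) fpair mpair).
rewrite (simple_integral_comp (@snd V V) fpair mpair).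
rewrite !fsbig_finite//= scaler_sumr -big_split/=; apply: eq_bigr => w _.
by rewrite scalerDr !scalerA mulrC.
Qed.

End Pair.

Lemma simple_integral_integrable s : simple_function s -> integrable_simple_function mu E s.
Proof.
move=> ss; split=> // v _.
by have := finite_measure_sub (ss.2 v); rewrite ge0_fin_numE.
Qed.

Lemma rnorm_simple_integral s : simple_function s ->
  ((rnorm (simple_integral mu E s))%:E <= \int[mu]_(t in E) (rnorm (s t))%:E)%E.
Proof.
move=> [fs ms]; rewrite /simple_integral fsbig_finite//=.
pose vs : seq V := finmap.enum_fset (fset_set (range s)).
(* At a point [t] only the value [v = s t] contributes to this sum of weighted indicators. *)
rewrite (eq_integral (fun t => \sum_(v <- vs) ((rnorm v)%:E * (\1_(s @^-1` [set v]) t)%:E)%E)%E).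
  rewrite ge0_integral_sum//; last 2 first.
  - move=> v; apply: measurable_funeM; apply/measurable_EFinP.
    exact: measurable_indic.
  - by move=> v t _; rewrite -EFinM lee_fin mulr_ge0// rnorm_ge0.
  apply: (@le_trans _ _ (\sum_(v <- vs)
      (rnorm ((fine (mu (E `&` s @^-1` [set v])))%:C *: v))%:E)%E).
    rewrite sumEFin lee_fin.
    by elim/big_rec2: _ => [|v x y _ xy]; rewrite ?rnorm0// (le_trans (rnormD _ _))// lerD2l.
  apply: lee_sum => v _; rewrite rnormZR ?fine_ge0//.
  rewrite ge0_integralZl_EFin//; last 2 first.
  - by apply/measurable_EFinP; exact: measurable_indic.
  - exact: rnorm_ge0.
  by rewrite integral_indic// [_ `&` E]setIC EFinM muleC fineK//; exact: finite_measure_sub.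
move=> t _; pose F v := ((rnorm v)%:E * (\1_(s @^-1` [set v]) t)%:E)%E.
transitivity (\sum_(v \in range s) F v)%E; last by rewrite fsbig_finite.
rewrite (fsbigD1 (s t))//=; last by exists t.
rewrite fsbig1 /F => [|v [_ /= vs0]]; first by rewrite indicE mem_set// mule1 adde0.
by rewrite indicE memNset ?mule0//= => sv; exact: vs0.
Qed.


End SimpleIntegral.

Section BochnerTheory.
Context d (T : measurableType d) {R : realType} (mu : {measure set T -> \bar R}).
Variables (E : set T) (mE : measurable E) (Efin : (mu E < +oo)%E).

Section Normed.
Context {V : normedModType R[i]}.
Implicit Types (f g s : T -> V) (v w : V).

Lemma simple_function_sm s : simple_function s -> strongly_measurable mu E s.
Proof. by move=> ss; apply: strong_strongly_measurable => //; exact: simple_function_strong. Qed.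

Lemma has_bochner_integral_scaleD (a : R[i]) f g v w :
  has_bochner_integral mu E f v -> has_bochner_integral mu E g w ->
  has_bochner_integral mu E (fun t => a *: f t + g t) (a *: v + w).
Proof.
move=> [sf [s_ [ss fs sv]]] [sg [s'_ [ss' gs sw]]]; split.
  exact: strongly_measurable_scaleD.
exists (fun n t => a *: s_ n t + s'_ n t); split.
- move=> n; apply: simple_integral_integrable => //.
  by apply: simple_function_scaleD; [case: (ss n)|case: (ss' n)].
- pose u n := ((complex.Re `|a|)%:E * (\int[mu]_(t in E) (rnorm (f t - s_ n t))%:E) +
    1%:E * (\int[mu]_(t in E) (rnorm (g t - s'_ n t))%:E))%E.
  apply: (@squeeze_cvge _ _ _ _ (cst 0%E) _ u).
  + near=> n; rewrite integral_ge0/=; last by move=> t _; rewrite lee_fin rnorm_ge0.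
    apply: le_integral_rnormD => //.
    * by rewrite -(@ler0c R) RRe_real// ger0_real.
    * by apply: strongly_measurableB => //; apply: simple_function_sm; case: (ss n).
    * by apply: strongly_measurableB => //; apply: simple_function_sm; case: (ss' n).
    * apply: aeW => t _; rewrite -rnormZ mul1r scalerBr opprD addrACA.
      exact: rnormD.
  + exact: cvg_cst.
  + rewrite -[X in _ --> X](_ : ((complex.Re `|a|)%:E * 0 + 1%:E * 0)%E = 0%E); last first.
      by rewrite !mule0 adde0.
    by apply: cvgeD; [rewrite !mule0|exact: cvgeZl|exact: cvgeZl].
- rewrite (_ : (fun n => _) = (fun n => a *: simple_integral mu E (s_ n) +
      simple_integral mu E (s'_ n))).
    by apply: cvgD => //; apply: cvgZ => //; exact: cvg_cst.
  apply/funext => n; apply: simple_integral_scaleD => //.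
    by case: (ss n).
  by case: (ss' n).
Unshelve. all: by end_near. Qed.

Lemma rnorm_has_bochner_integral f v : has_bochner_integral mu E f v ->
  ((rnorm v)%:E <= \int[mu]_(t in E) (rnorm (f t))%:E)%E.
Proof.
move=> [sf [s_ [ss fs sv]]].
have [|foo] := leP (+oo)%E (\int[mu]_(t in E) (rnorm (f t))%:E)%E.
  by rewrite leye_eq => /eqP ->; exact: leey.
have ffin : (\int[mu]_(t in E) (rnorm (f t))%:E)%E \is a fin_num.
  by rewrite ge0_fin_numE// integral_ge0// => t _; rewrite lee_fin rnorm_ge0.
pose u n := (1%:E * (\int[mu]_(t in E) (rnorm (f t))%:E) +
  1%:E * (\int[mu]_(t in E) (rnorm (f t - s_ n t))%:E))%E.
have cv : (rnorm (simple_integral mu E (s_ n)))%:E @[n --> \oo] --> (rnorm v)%:E.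
  by apply: cvg_EFin; [exact: nearW|exact: cvg_rnorm].
have cu : u n @[n --> \oo] --> (\int[mu]_(t in E) (rnorm (f t))%:E)%E.
  rewrite -[X in _ --> X]adde0 -[X in (X + _)%E]mul1e -[X in (_ + X)%E](mule0 1%:E).
  apply: cvgeD; [by rewrite mule0 mul1e fin_num_adde_defl|exact: cvg_cst|exact: cvgeZl].
apply: (lee_cvg_to cv cu); near=> n.
apply: le_trans (rnorm_simple_integral mE Efin _) _; first by case: (ss n).
apply: le_integral_rnormD => //.
  by apply: strongly_measurableB => //; apply: simple_function_sm; case: (ss n).
apply: aeW => t _; rewrite !mul1r.
by rewrite -{1}(subKr (f t) (s_ n t)) rnormB.
Unshelve. all: by end_near. Qed.

(** The vector [w - v] is an integral of [- f + f], so its norm is at most the integral of 0. *)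
Lemma has_bochner_integral_unique f v w :
  has_bochner_integral mu E f v -> has_bochner_integral mu E f w -> v = w.
Proof.
move=> fv fw; have := rnorm_has_bochner_integral (has_bochner_integral_scaleD (-1) fv fw).
rewrite integral0_eq => [|t _]; last by rewrite scaleN1r addNr rnorm0.
rewrite lee_fin scaleN1r => h; apply/esym/eqP; rewrite -subr_eq0 addrC.
by apply/eqP/rnorm0_eq0/le_anti; rewrite h rnorm_ge0.
Qed.

Lemma bochner_integralE f v : has_bochner_integral mu E f v ->
  bochner_integral mu E f = v.
Proof.
move=> fv; apply: (@has_bochner_integral_unique f) => //.
by rewrite /bochner_integral; case: xgetP => //= /(_ v).
Qed.

Lemma has_bochner_integral_ext f g v : (forall t, E t -> f t = g t) ->
  has_bochner_integral mu E f v -> has_bochner_integral mu E g v.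
Proof.
move=> fg [sf [s_ [ss fs sv]]]; split; first exact: strongly_measurable_ext sf.
exists s_; split=> //.
rewrite (_ : (fun n => _) = (fun n => \int[mu]_(t in E) (rnorm (f t - s_ n t))%:E)%E)//.
by apply/funext => n; apply: eq_integral => t /set_mem Et; rewrite fg.
Qed.

Lemma has_bochner_integral_cst (A : set T) (c : V) : measurable A -> A `<=` E -> A !=set0 ->
  has_bochner_integral mu E (patch (fun=> 0) A (cst c)) ((fine (mu A))%:C *: c).
Proof.
move=> mA AE [t0 At0].
pose phi (b : bool) := if b then c else 0.
have fr : finite_set (range (fun t => t \in A)) by exact: finite_finset.
have mr b : measurable ((fun t => t \in A) @^-1` [set b]).
  case: b.
    by rewrite (_ : _ @^-1` _ = A)//; apply/seteqP; split=> t; [exact: set_mem|exact: mem_set].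
  rewrite (_ : _ @^-1` _ = ~` A); first exact: measurableC.
  apply/seteqP; split=> t /=; first by move=> tA /mem_set; rewrite tA.
  by move=> nAt; rewrite memNset.
have phiE : patch (fun=> 0) A (cst c) = phi \o (fun t => t \in A).
  by [].
have sA : simple_function (patch (fun=> 0) A (cst c)).
  by rewrite phiE; exact: simple_function_comp fr mr.
split; first exact: simple_function_sm.
exists (fun=> patch (fun=> 0) A (cst c)); split.
- by move=> _; exact: simple_integral_integrable.
- rewrite integral0_eq => [|t _]; first exact: cvg_cst.
  by rewrite subrr rnorm0.
- have := simple_integral_comp mE Efin phi fr mr.
  rewrite (fsbigD1 true)//=; last by exists t0; rewrite ?mem_set.
  rewrite fsbig1; last by case=> [[_ /= /(_ erefl)]//|_]; rewrite scaler0.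
  rewrite addr0 (_ : E `&` _ = A); last first.
    by apply/seteqP; split=> t /=; [by case=> _ /set_mem|move=> At; split; [exact: AE|exact: mem_set]].
  by rewrite -phiE => ->; exact: cvg_cst.
Qed.

End Normed.

(** The simple functions of [strong_approx] converge to [f] in L^1 by domination, so their integrals
    form a Cauchy sequence; completeness of [V] supplies the limit. *)
Lemma has_bochner_integral_exists (V : completeNormedModType R[i]) (f : T -> V) :
  strongly_measurable mu E f -> (\int[mu]_(t in E) (rnorm (f t))%:E < +oo)%E ->
  exists v, has_bochner_integral mu E f v.
Proof.
move=> sf foo; have [f' [N [sf' mN N0 ff']]] := (strongly_measurableP mu mE f).1 sf.
have [q [k [mk km fk kf]]] := strong_approx sf'.
have ss n : simple_function (q \o k n) by exact: (simple_function_nat _ (mk n) (km n)).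
have mr (u : T -> V) : strong u -> measurable_fun E (fun t => (rnorm (u t))%:E).
  by move=> /strong_rnorm su; apply/measurable_EFinP; exact: measurable_funTS.
have fs : (\int[mu]_(t in E) (rnorm (f t - q (k n t)))%:E)%E @[n --> \oo] --> 0%E.
  rewrite (_ : (fun n => _) = (fun n => \int[mu]_(t in E) (rnorm (f' t - q (k n t)))%:E)%E); last first.
    apply/funext => n; apply: (ae_ge0_eq_lower_integral mE mN N0).
    - by move=> t _; rewrite lee_fin rnorm_ge0.
    - by move=> t _; rewrite lee_fin rnorm_ge0.
    - by move=> t Et Nt; rewrite ff'.
  rewrite -(integral0 mu E).
  apply: (@dominated_cvg _ _ _ _ _ mE _ _ (fun t => (rnorm (f' t))%:E)) => //.
  - move=> n; apply: mr.
    exact: (@strong_glue _ _ _ _ (fun j t => f' t - q j) _ (mk n) (fun j => strongDr _ sf')).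
  - move=> t _; apply: cvg_EFin; first exact: nearW.
    rewrite (_ : fine \o _ = (fun n => rnorm (q (k n t) - f' t))).
      by apply/cvg_rnormP; exact: kf.
    by apply/funext => n; rewrite rnormB_sym.
  - apply/integrableP; split; first exact: mr.
    rewrite (eq_integral (fun t => (rnorm (f' t))%:E)); last first.
      by move=> t _; rewrite gee0_abs// lee_fin rnorm_ge0.
    rewrite (le_lt_trans _ foo)// (ae_ge0_le_lower_integral mE mN N0)//.
    + by move=> t _; rewrite lee_fin rnorm_ge0.
    + by move=> t _; rewrite lee_fin rnorm_ge0.
    + by move=> t Et Nt; rewrite ff'.
  - by move=> n t Et; rewrite gee0_abs lee_fin ?rnorm_ge0.
suff : cvgn (fun n => simple_integral mu E (q \o k n)).
  move=> cv; exists (limn (fun n => simple_integral mu E (q \o k n))).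
  split=> //; exists (fun n => q \o k n); split=> // n.
  exact: simple_integral_integrable.
apply: cauchy_cvg; apply: cauchy_exP => -[e e'].
rewrite ltcE/= => /andP[/eqP -> e0].
have e20 : 0 < e / 2 by rewrite divr_gt0.
have [n _ hn] : \forall n \near \oo,
    (\int[mu]_(t in E) (rnorm (f t - q (k n t)))%:E < (e / 2)%:E)%E.
  apply: (fs [set x | (x < (e / 2)%:E)%E]); apply: open_nbhs_nbhs; split.
    exact: open_ereal_lt_ereal.
  by rewrite /= lte_fin.
exists (simple_integral mu E (q \o k n)), n => // m /= nm.
rewrite -ball_normE/= rnormE ltcR -lte_fin.
have := simple_integral_scaleD mE Efin (ss m) (ss n) (-1).
rewrite scaleN1r addrC => <-.
have sq j : strongly_measurable mu E (fun t => f t - q (k j t)).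
  exact: strongly_measurableB sf (simple_function_sm (ss j)).
apply: le_lt_trans (rnorm_simple_integral mE Efin _) _.
  exact: simple_function_scaleD.
apply: le_lt_trans (le_integral_rnormD (a := 1) (b := 1) mE _ _ (sq m) (sq n) _) _ => //.
  apply: aeW => t _; rewrite !mul1r scaleN1r/=.
  apply: le_trans (rnormB _ _); rewrite opprB [leRHS](_ : _ = rnorm (- q (k m t) + q (k n t)))//.
  by congr rnorm; rewrite [LHS]addrC subrKA addrC.
rewrite !mul1e (splitr e) EFinD lteD//; apply: hn => //=.
Qed.

End BochnerTheory.

Section BochnerRestriction.
Context d (T : measurableType d) {R : realType} (mu : {measure set T -> \bar R}).
Variables (E E' : set T) (mE : measurable E) (mE' : measurable E') (EE' : E `<=` E').
Variables (Efin : (mu E' < +oo)%E) (V : normedModType R[i]).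
Implicit Types (f s : T -> V).

Lemma simple_function_patch s : simple_function s -> simple_function (patch (fun=> 0) E s).
Proof.
move=> [fs ms]; pose r t := (t \in E, s t).
rewrite (_ : patch _ _ _ = (fun w : bool * V => if w.1 then w.2 else 0) \o r)//.
apply: simple_function_comp.
  apply: (@sub_finite_set _ _ ([set: bool] `*` range s)); last exact: finite_setX.
  by move=> _ [t _ <-]; split => //; exists t.
move=> [b v]; rewrite (_ : _ @^-1` _ =
    (if b then E else ~` E) `&` s @^-1` [set v]).
  by apply: measurableI => //; case: b => //; exact: measurableC.
apply/seteqP; split=> t /=.
  by move=> [<- ->]; split=> //; case: ifPn => [/set_mem|/negP h] //; move=> /mem_set.
by case: b => -[+ <-]; rewrite /r; [move=> /mem_set ->|move=> nEt; rewrite memNset].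
Qed.

(** Values that are not attained have empty fibres and contribute 0. Summing over all of [V] lets
    the integrals of functions with different ranges be compared term by term. *)
Lemma simple_integralT (A : set T) s : simple_integral mu A s =
  \sum_(v \in [set: V]) (fine (mu (A `&` s @^-1` [set v])))%:C *: v.
Proof.
apply: fsbig_widen => // v [_ /= nv].
rewrite (_ : A `&` _ = set0) ?measure0/= ?scale0r//.
by apply/seteqP; split=> t //= [_ sv]; apply: nv; exists t.
Qed.

Lemma simple_integral_patch s :
  simple_integral mu E' (patch (fun=> 0) E s) = simple_integral mu E s.
Proof.
rewrite !simple_integralT; apply: eq_fsbigr => v _.
(* Extension by 0 changes only the fibre of 0, whose term vanishes anyway. *)
have [->|/eqP v0] := eqVneq v 0; first by rewrite !scaler0.
congr ((fine (mu _))%:C *: v); apply/seteqP; split=> t /=; rewrite /patch.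
  by case: ifPn => [/set_mem Et [] //|_ [_ /esym]].
by move=> [Et sv]; rewrite mem_set//; split => //; exact: EE'.
Qed.

(** This brings integrals over different intervals to a common domain, as needed to move the lower
    limit in [Gop_from] and to compare [Gop] at different times. *)
Lemma has_bochner_integral_patch f v : has_bochner_integral mu E f v ->
  has_bochner_integral mu E' (patch (fun=> 0) E f) v.
Proof.
move=> [sf [s_ [ss fs sv]]]; split; first exact: strongly_measurable_patch.
exists (fun n => patch (fun=> 0) E (s_ n)); split.
- move=> n; apply: simple_integral_integrable => //.
  by apply: simple_function_patch; case: (ss n).
- rewrite (_ : (fun n => _) = (fun n => \int[mu]_(t in E) (rnorm (f t - s_ n t))%:E)%E)//.
  apply/funext => n; rewrite integral_mkcond [RHS]integral_mkcond.
  apply: eq_integral => t _; rewrite !patchE /patch.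
  case: (boolP (t \in E)) => [/set_mem/EE'/mem_set -> //|_].
  by case: ifPn => //; rewrite subrr rnorm0.
- rewrite (_ : (fun n => _) = (fun n => simple_integral mu E (s_ n)))//.
  by apply/funext => n; exact: simple_integral_patch.
Qed.

End BochnerRestriction.

(** * Young's inequality *)

Section ExponentialKernel.
Context {R : realType}.
Local Notation mu := (@lebesgue_measure R).
Variables (nu : R) (nu0 : 0 < nu).

Let k s (t : R) := expR (- nu * (t - s)).

Lemma is_derive_expR_affine (a b t : R) :
  is_derive t 1 (fun t => expR (a * (t - b))) (a * expR (a * (t - b))).
Proof.
have h : is_derive t 1 (fun t : R => a * (t - b)) a.
  by apply: is_derive_eq; rewrite subr0 /GRing.scale/= mulr1.
have := is_derive1_comp (is_derive_expR _) h.
by rewrite mulrC.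
Qed.

Let F s (t : R) : R := - nu^-1 * k s t.

Let dF s (t : R) : is_derive t 1 (F s) (k s t).
Proof.
have h := is_derive_expR_affine (- nu) s t.
apply: is_derive_eq.
by rewrite /GRing.scale/= mulrA mulrNN mulVf ?gt_eqF// mul1r.
Qed.

Let ck s : continuous (k s).
Proof.
move=> t; apply: differentiable_continuous; apply/derivable1_diffP.
by have [] := is_derive_expR_affine (- nu) s t.
Qed.

Let cF s : continuous (F s).
Proof.
by move=> t; apply: differentiable_continuous; apply/derivable1_diffP; have [] := dF s t.
Qed.

(** Young's inequality needs the mass of the kernel in each variable. This one, over the later time,
    is used after Tonelli; [integral_expR_head], over the earlier time, is used in Jensen's
    inequality. *)
Lemma integral_expR_tail s :
  (\int[mu]_(t in `[s, +oo[) (expR (- nu * (t - s)))%:E = (nu^-1)%:E)%E.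
Proof.
rewrite (@ge0_continuous_FTC2y _ (k s) (F s) s 0).
- by rewrite /F /k subrr mulr0 expR0 mulr1 -EFinB sub0r opprK.
- by move=> x _; exact: expR_ge0.
- exact/continuous_subspaceT/ck.
- rewrite -[X in _ --> X](mulr0 (- nu^-1)); apply: cvgM; first exact: cvg_cst.
  rewrite (_ : k s = (fun x => expR (- x)) \o (fun x => nu * (x - s))); last first.
    by apply/funext => x; rewrite /k /= mulNr.
  apply: cvg_comp (@cvgr_expR R); apply/cvgryPge => A; near=> x.
  rewrite -ler_pdivrMl// lerBrDr; near: x.
  by apply: nbhs_pinfty_ge; rewrite num_real.
- by move=> x _; have [] := dF s x.
- exact/cvg_at_right_filter/cF.
- by move=> x _; rewrite derive1E; have [] := dF s x.
Unshelve. all: by end_near. Qed.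

Lemma integral_expR_head t : 0 <= t ->
  (\int[mu]_(s in `[0%R, t]) (expR (- nu * (t - s)))%:E <= (nu^-1)%:E)%E.
Proof.
(* The degenerate interval is set apart because the fundamental theorem of calculus is applied with
   [0 < t]. *)
rewrite le_eqVlt => /predU1P[<-|t0].
  by rewrite set_itv1 integral_set1 lee_fin invr_ge0 ltW.
have -> : (fun s => (expR (- nu * (t - s)))%:E) = (fun s => (expR (nu * (s - t)))%:E).
  by apply/funext => s; rewrite mulNr -mulrN opprB.
pose G s := nu^-1 * expR (nu * (s - t)).
have dG (s : R) : is_derive s 1 G (expR (nu * (s - t))).
  have h := is_derive_expR_affine nu t s.
  by apply: is_derive_eq; rewrite /GRing.scale/= mulrA mulVf ?gt_eqF// mul1r.
have cG : continuous G.
  by move=> s; apply: differentiable_continuous; apply/derivable1_diffP; have [] := dG s.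
rewrite (@continuous_FTC2 _ (fun s => expR (nu * (s - t))) G 0 t t0).
- rewrite /G subrr mulr0 expR0 mulr1 -EFinB lee_fin lerBlDr lerDl.
  by rewrite mulr_ge0 ?expR_ge0// invr_ge0 ltW.
- apply: continuous_subspaceT => s; apply: differentiable_continuous.
  by apply/derivable1_diffP; have [] := is_derive_expR_affine nu t s.
- split; first by move=> s _; have [] := dG s.
    exact/cvg_at_right_filter/cG.
  exact/cvg_at_left_filter/cG.
- by move=> s _; rewrite derive1E; have [] := dG s.
Qed.

End ExponentialKernel.

Section Young.
Context {R : realType}.

(** The graph of the p-th power lies above its tangent at [m]. This is Young's inequality for the
    product of [a] and m^(p-1) with exponents [p] and [p / (p - 1)], which is why [p = 1] is treated
    separately. *)
Lemma powR_tangent (p a m : R) : 1 <= p -> 0 <= a -> 0 <= m ->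
  p * m `^ (p - 1) * a <= a `^ p + (p - 1) * m `^ p.
Proof.
rewrite le_eqVlt => /predU1P[<-|p1] a0 m0.
  by rewrite subrr mul0r powRr0 !mul1r powRr1// addr0.
have p0 : 0 < p by lra.
have p10 : 0 < p - 1 by lra.
have q0 : 0 < p / (p - 1) by rewrite divr_gt0.
have := conjugate_powR a0 (powR_ge0 m (p - 1)) p0 q0.
rewrite -powRrM [(p - 1) * _]mulrC divfK ?gt_eqF// => h.
have {}h : a * m `^ (p - 1) <= a `^ p / p + m `^ p / (p / (p - 1)).
  by apply: h; field; rewrite !gt_eqF.
rewrite -(ler_pM2l p0) in h; apply: le_trans (_ : p * (a * m `^ (p - 1)) <= _).
  by rewrite mulrAC mulrA.
by apply: (le_trans h); rewrite le_eqVlt; apply/orP; left; apply/eqP; field; rewrite !gt_eqF.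
Qed.

(* Integrates the tangent line inequality at the mean value [y / K] of [phi]. *)
Lemma jensen_powR d (T : measurableType d) (mu : {measure set T -> \bar R})
    (D : set T) (k phi : T -> R) (p K y : R) : measurable D ->
  measurable_fun D k -> measurable_fun D phi ->
  (forall t, 0 <= k t) -> (forall t, 0 <= phi t) ->
  1 <= p -> 0 < K -> 0 <= y ->
  (\int[mu]_(t in D) (k t)%:E <= K%:E)%E ->
  (y%:E <= \int[mu]_(t in D) (k t * phi t)%:E)%E ->
  ((y `^ p)%:E <= (K `^ (p - 1))%:E * \int[mu]_(t in D) (k t * phi t `^ p)%:E)%E.
Proof.
move=> mD mk mphi k0 phi0 p1 K0 y0 kK yk.
have p0 : 0 < p by lra.
set I := (\int[mu]_(t in D) (k t * phi t `^ p)%:E)%E.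
have I0 : (0 <= I)%E.
  by apply: integral_ge0 => t _; rewrite lee_fin mulr_ge0// powR_ge0.
have KV0 : 0 < K `^ (p - 1) by rewrite powR_gt0.
pose m := y / K.
have m0 : 0 <= m by rewrite divr_ge0// ltW.
have c0 : 0 <= p * m `^ (p - 1) by rewrite mulr_ge0 ?powR_ge0// ltW.
have c10 : 0 <= (p - 1) * m `^ p by rewrite mulr_ge0 ?powR_ge0// subr_ge0.
have mkphi : measurable_fun D (fun t => (k t * phi t)%:E).
  by apply/measurable_EFinP; exact: measurable_funM.
have mkphip : measurable_fun D (fun t => (k t * phi t `^ p)%:E).
  apply/measurable_EFinP; apply: measurable_funM => //.
  exact: (measurableT_comp (measurable_powR p)).
have key : ((p * m `^ (p - 1) * y)%:E <= I + ((p - 1) * m `^ p * K)%:E)%E.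
  apply: (@le_trans _ _ (\int[mu]_(t in D) ((p * m `^ (p - 1))%:E * (k t * phi t)%:E))%E).
    rewrite ge0_integralZl_EFin//; last by move=> t _; rewrite lee_fin mulr_ge0.
    by rewrite EFinM lee_wpmul2l.
  apply: (@le_trans _ _ (\int[mu]_(t in D)
      ((k t * phi t `^ p)%:E + ((p - 1) * m `^ p)%:E * (k t)%:E))%E).
    apply: ge0_le_integral => //.
    - by move=> t _; rewrite -EFinM lee_fin !mulr_ge0// ?powR_ge0// ltW.
    - exact: measurable_funeM.
    - apply: emeasurable_funD => //; apply: measurable_funeM.
      exact/measurable_EFinP.
    - move=> t _; rewrite -!EFinM -EFinD lee_fin.
      have := ler_wpM2l (k0 t) (powR_tangent p1 (phi0 t) m0).
      by rewrite mulrDr mulrCA [_ * k t]mulrC.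
  rewrite ge0_integralD//; last 3 first.
  - by move=> t _; rewrite lee_fin mulr_ge0// powR_ge0.
  - by move=> t _; rewrite -EFinM lee_fin mulr_ge0.
  - by apply: measurable_funeM; exact/measurable_EFinP.
  rewrite leeD2l// ge0_integralZl_EFin//; last 2 first.
  - by move=> t _; rewrite lee_fin.
  - exact/measurable_EFinP.
  by rewrite [leRHS]EFinM lee_wpmul2l// lee_fin.
have [Ioo|Ifin] := eqVneq I +oo%E.
  by rewrite Ioo gt0_muley ?lte_fin// leey.
have {Ifin} : I \is a fin_num by rewrite ge0_fin_numE// ltey.
move=> /fineK Ie; rewrite -Ie -EFinD lee_fin in key.
rewrite -Ie -EFinM lee_fin.
(* With [y = m * K], [key] becomes m^p K <= I, and multiplying by K^(p-1) gives y^p on the left. *)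
have yE : y = m * K by rewrite /m divfK// gt_eqF.
have mp : m * m `^ (p - 1) = m `^ p by exact: mulr_powRB1.
have Kp : K * K `^ (p - 1) = K `^ p by apply: mulr_powRB1 => //; exact: ltW.
rewrite yE powRM//; last exact: ltW.
rewrite -Kp mulrA [leRHS]mulrC ler_pM2r//.
rewrite yE in key.
have -> : m `^ p * K = p * m `^ (p - 1) * (m * K) - (p - 1) * m `^ p * K.
  by rewrite -mp; ring.
by rewrite lerBlDr.
Qed.

End Young.

Section Convolution.
Context {R : realType}.
Local Notation mu := (@lebesgue_measure R).
Variables (nu : R) (nu0 : 0 < nu) (psi : R -> R).
Hypotheses (mpsi : measurable_fun setT psi) (psi0 : forall t, 0 <= psi t).

Let S : set (R * R) := [set z | 0 <= z.2] `&` [set z | z.2 <= z.1].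

Let mS : measurable S.
Proof.
apply: measurableI.
  have := measurable_fun_ler (measurable_cst (0 : R)) (@measurable_snd _ _ R R).
  by move=> /(_ measurableT [set true] I); rewrite setTI.
have := measurable_fun_ler (@measurable_snd _ _ R R) (@measurable_fst _ _ R R).
by move=> /(_ measurableT [set true] I); rewrite setTI.
Qed.

(** Cutting the kernel off to the triangle [S] replaces the moving interval of integration by the
    whole line, so that Tonelli's theorem applies. *)
Let F (z : R * R) : \bar R :=
  (expR (- nu * (z.1 - z.2)) * psi z.2 * \1_S z)%:E.

Let F0 z : (0 <= F z)%E.
Proof. by rewrite lee_fin !mulr_ge0 ?expR_ge0. Qed.

Let mF : measurable_fun setT F.
Proof.
apply/measurable_EFinP; apply: measurable_funM; last exact: measurable_indic.
apply: measurable_funM; last exact: measurableT_comp.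
apply: measurableT_comp => //; apply: measurable_funM => //.
exact: measurable_funB.
Qed.

Let F_head t : 0 <= t -> (\int[mu]_s F (t, s) =
  \int[mu]_(s in `[0%R, t]) (expR (- nu * (t - s)) * psi s)%:E)%E.
Proof.
move=> t0; rewrite [RHS]integral_mkcond; apply: eq_integral => s _.
rewrite patchE /F /= indicE; case: ifPn => [/set_mem|/negP h].
  by rewrite /= in_itv/= => /andP[s0 st]; rewrite mem_set ?mulr1.
rewrite memNset ?mulr0// => -[/= s0 st]; apply: h; apply/mem_set => /=.
by rewrite in_itv/= s0.
Qed.

Lemma measurable_expR_convolution : measurable_fun (@Rplus R)
  (fun t => \int[mu]_(s in `[0%R, t]) (expR (- nu * (t - s)) * psi s)%:E)%E.
Proof.
apply: (eq_measurable_fun (fun t => \int[mu]_s F (t, s)))%E.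
  by move=> t; rewrite inE /Rplus /= in_itv/= andbT => /F_head.
apply: measurable_funTS; exact: (@measurable_fun_fubini_tonelli_F _ _ _ _ R mu F mF F0).
Qed.

Lemma integral_expR_convolution :
  (\int[mu]_(t in Rplus) \int[mu]_(s in `[0%R, t]) (expR (- nu * (t - s)) * psi s)%:E <=
   (nu^-1)%:E * \int[mu]_(s in Rplus) (psi s)%:E)%E.
Proof.
apply: (@le_trans _ _ (\int[mu]_t \int[mu]_s F (t, s))%E).
  rewrite integral_mkcond; apply: ge0_le_lower_integral => t _; rewrite patchE.
    by case: ifPn => // _; apply: integral_ge0 => s _; rewrite lee_fin mulr_ge0// expR_ge0.
  case: ifPn => [/set_mem|_]; last exact: integral_ge0.
  by rewrite /Rplus/= in_itv/= andbT => /F_head ->.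
(* In the exchanged order, for each [s >= 0] the integration over [t] runs over [t >= s] and
   produces the mass [nu^-1]. *)
rewrite fubini_tonelli//= -ge0_integralZl_EFin//; last 4 first.
- exact: measurable_itv.
- by move=> s _; rewrite lee_fin.
- by apply/measurable_EFinP; exact: measurable_funTS.
- by rewrite invr_ge0 ltW.
rewrite [leRHS]integral_mkcond; apply: ge0_le_lower_integral => s _.
  exact: integral_ge0.
rewrite patchE; case: ifPn => [/set_mem|/negP h]; last first.
  rewrite integral0_eq// => t _; rewrite /F indicE memNset ?mulr0//= => -[/= s0 _].
  by apply: h; apply/mem_set; rewrite /Rplus/= in_itv/= s0.
rewrite /Rplus/= in_itv/= andbT => s0.
rewrite -(integral_expR_tail nu0 s) muleC -ge0_integralZl_EFin//; last first.
  apply/measurable_EFinP; apply: measurable_funTS.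
  apply: measurableT_comp => //; apply: measurable_funM => //.
  exact: measurable_funB.
rewrite [leRHS]integral_mkcond; apply: ge0_le_lower_integral => t _ //.
rewrite patchE; case: ifPn => [_|/negP h].
  rewrite /F/= -EFinM lee_fin [leRHS]mulrC ler_piMr ?mulr_ge0 ?expR_ge0//.
rewrite /F indicE memNset ?mulr0//= => -[/= _ st]; apply: h.
by apply/mem_set; rewrite /= in_itv/= st.
Qed.

End Convolution.

(** * L^p spaces *)

Section PowerIntegral.
Context {R : realType}.
Local Notation mu := (@lebesgue_measure R).
Variables (p : R) (p1 : 1 <= p).

Let p0 : 0 < p. Proof. exact: lt_le_trans p1. Qed.
Let pn0 : p != 0. Proof. by rewrite gt_eqF. Qed.

Lemma measurable_Rplus : measurable (@Rplus R).
Proof. exact: measurable_itv. Qed.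

Section OneSpace.
Context {V : normedModType R[i]}.
Implicit Types (f : R -> V).

(** By [Lp_norm_pow] this is the p-th power of [Lp_norm]. Being a plain integral, it is estimated by
    pointwise inequalities without taking roots. *)
Definition pow_integral f : \bar R := (\int[mu]_(t in Rplus) (rnorm (f t) `^ p)%:E)%E.

Lemma pow_integral_ge0 f : (0 <= pow_integral f)%E.
Proof. by apply: integral_ge0 => t _; rewrite lee_fin powR_ge0. Qed.

Lemma Lp_norm_pow f : (Lp_norm p f `^ p = pow_integral f)%E.
Proof.
rewrite /Lp_norm poweR_Lnorm// /pow_integral [RHS]integral_mkcond.
apply: eq_integral => t _; rewrite !patchE; case: ifPn => _.
  by rewrite gee0_abs ?lee_fin ?rnorm_ge0// poweR_EFin.
by rewrite abse0 poweR0r.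
Qed.

Lemma Lp_normE f : Lp_norm p f = (pow_integral f `^ p^-1)%E.
Proof. by rewrite -Lp_norm_pow -poweRrM divff// poweRe1// Lnorm_ge0. Qed.

Lemma in_LpP f : in_Lp p f <->
  strongly_measurable mu Rplus f /\ (pow_integral f < +oo)%E.
Proof.
split=> -[sf]; rewrite -Lp_norm_pow => h; split=> //; first exact: poweR_lty.
exact: lty_poweRy h.
Qed.

Lemma ae_le_pow_integral f N (phi : R -> \bar R) : measurable N -> mu N = 0%E ->
  (forall t, 0 <= phi t)%E ->
  (forall t, 0 <= t -> ~ N t -> ((rnorm (f t) `^ p)%:E <= phi t)%E) ->
  (pow_integral f <= \int[mu]_(t in Rplus) phi t)%E.
Proof.
move=> mN N0 phi0 fphi.
apply: (@ae_ge0_le_lower_integral _ _ _ mu _ N _ _ measurable_Rplus mN N0).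
- by move=> t _; rewrite lee_fin powR_ge0.
- by [].
- by move=> t; rewrite /Rplus/= in_itv/= andbT; exact: fphi.
Qed.

Lemma strongly_measurable_pow f : strongly_measurable mu Rplus f ->
  exists (phi : R -> R) N, [/\ measurable_fun setT phi, forall t, 0 <= phi t,
    measurable N, mu N = 0%E & forall t, 0 <= t -> ~ N t -> rnorm (f t) = phi t].
Proof.
move=> /(strongly_measurableP mu measurable_Rplus)[f' [N [sf mN N0 ff']]].
exists (fun t : R => rnorm (f' t)), N; split=> //; first exact: strong_rnorm.
  by move=> t; exact: rnorm_ge0.
by move=> t t0 Nt; rewrite ff'// /Rplus/= in_itv/= t0.
Qed.

Lemma pow_integral_rep f (phi : R -> R) N : measurable N -> mu N = 0%E ->
  (forall t, 0 <= phi t) ->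
  (forall t, 0 <= t -> ~ N t -> rnorm (f t) = phi t) ->
  pow_integral f = (\int[mu]_(t in Rplus) (phi t `^ p)%:E)%E.
Proof.
move=> mN N0 phi0 fphi.
apply: (@ae_ge0_eq_lower_integral _ _ _ mu _ N _ _ measurable_Rplus mN N0).
- by move=> t _; rewrite lee_fin powR_ge0.
- by move=> t _; rewrite lee_fin powR_ge0.
- by move=> t; rewrite /Rplus/= in_itv/= andbT => t0 Nt; rewrite fphi.
Qed.

End OneSpace.

Lemma measurable_pow (D : set R) (phi : R -> R) : measurable_fun setT phi ->
  measurable_fun D (fun t => (phi t `^ p)%:E).
Proof.
move=> mphi; apply/measurable_EFinP; apply: measurable_funTS.
exact: (measurableT_comp (measurable_powR p)).
Qed.

Lemma pow_integralZ (V W : normedModType R[i]) (f : R -> V) (g : R -> W) (c : R) :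
  0 <= c -> strongly_measurable mu Rplus g ->
  {ae mu, forall t, Rplus t -> rnorm (f t) <= c * rnorm (g t)} ->
  (pow_integral f <= (c `^ p)%:E * pow_integral g)%E.
Proof.
move=> c0 /strongly_measurable_pow[phi [N [mphi phi0 mN N0 gphi]]] [M [mM M0 fg]].
rewrite (pow_integral_rep mN N0 phi0 gphi) -ge0_integralZl_EFin//; last 4 first.
- exact: measurable_Rplus.
- by move=> t _; rewrite lee_fin powR_ge0.
- exact: measurable_pow.
- exact: powR_ge0.
apply: (@ae_le_pow_integral _ _ (N `|` M)); first exact: measurableU.
- by rewrite measureU0.
- by move=> t; rewrite -EFinM lee_fin mulr_ge0// powR_ge0.
- move=> t t0 /not_orP[Nt Mt].
  rewrite -EFinM lee_fin -powRM// ge0_ler_powR ?nnegrE ?rnorm_ge0 ?mulr_ge0//.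
    by rewrite ltW.
  rewrite -gphi//; apply: contrapT => h; apply: Mt; apply: fg => /= /(_ _).
  by move/(_ _)/h; apply; rewrite /Rplus/= in_itv/= t0.
Qed.

(** Pointwise, (a + b)^p <= (2 max(a, b))^p <= 2^p (a^p + b^p). The three spaces may differ since
    only norms are compared. *)
Lemma pow_integralD (V1 V2 V3 : normedModType R[i]) (f : R -> V1) (g : R -> V2)
    (h : R -> V3) :
  strongly_measurable mu Rplus f -> strongly_measurable mu Rplus g ->
  (forall t, 0 <= t -> rnorm (h t) <= rnorm (f t) + rnorm (g t)) ->
  (pow_integral h <= (2 `^ p)%:E * (pow_integral f + pow_integral g))%E.
Proof.
move=> /strongly_measurable_pow[phi [N [mphi phi0 mN N0 fphi]]].
move=> /strongly_measurable_pow[psi [M [mpsi psi0 mM M0 gpsi]]] hfg.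
rewrite (pow_integral_rep mN N0 phi0 fphi) (pow_integral_rep mM M0 psi0 gpsi).
rewrite -ge0_integralD//; last 5 first.
- exact: measurable_Rplus.
- by move=> t _; rewrite lee_fin powR_ge0.
- exact: measurable_pow.
- by move=> t _; rewrite lee_fin powR_ge0.
- exact: measurable_pow.
rewrite -ge0_integralZl_EFin ?powR_ge0//; last 3 first.
- exact: measurable_Rplus.
- by move=> t _; rewrite -EFinD lee_fin addr_ge0// powR_ge0.
- by apply: emeasurable_funD; exact: measurable_pow.
apply: (@ae_le_pow_integral _ _ (N `|` M)); first exact: measurableU.
- by rewrite measureU0.
- by move=> t; rewrite -EFinD -EFinM lee_fin mulr_ge0 ?addr_ge0 ?powR_ge0.
- move=> t t0 /not_orP[Nt Mt].
  rewrite -EFinD -EFinM lee_fin.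
  have {}hfg : rnorm (h t) <= phi t + psi t by rewrite -fphi// -gpsi// hfg.
  have mx : 0 <= Num.max (phi t) (psi t) by rewrite le_max phi0.
  apply: (@le_trans _ _ ((2 * Num.max (phi t) (psi t)) `^ p)).
    apply: ge0_ler_powR; [exact: ltW|exact: rnorm_ge0|by rewrite nnegrE mulr_ge0|].
    rewrite (le_trans hfg)// mulr_natl mulr2n lerD//; rewrite le_max lexx ?orbT//.
  rewrite powRM// ler_wpM2l ?powR_ge0//.
  by rewrite maxEle; case: ifP => _; rewrite ?lerDr ?lerDl powR_ge0.
Qed.

Lemma Lp_bounded_operatorE (V W : normedModType R[i]) (A : (R -> V) -> (R -> W)) :
  Lp_bounded_operator p A -> exists2 c, 0 <= c & forall f,
    strongly_measurable mu Rplus f -> (pow_integral f < +oo)%E ->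
    strongly_measurable mu Rplus (A f) /\
    (pow_integral (A f) <= c%:E * pow_integral f)%E.
Proof.
move=> [AL _ [c Ac]]; exists (Num.max c 0 `^ p); first exact: powR_ge0.
move=> f sf foo; have fL : in_Lp p f by apply/in_LpP.
split; first by case: (AL f fL).
rewrite -!Lp_norm_pow -poweR_EFin -poweRM ?Lnorm_ge0 ?lee_fin ?le_max ?lexx ?orbT//.
rewrite gt0_ler_poweR ?(ltW p0) ?in_itv/= ?leey ?andbT ?mule_ge0 ?Lnorm_ge0//.
  by rewrite lee_fin le_max lexx orbT.
apply: (le_trans (Ac f fL)); rewrite lee_wpmul2r ?Lnorm_ge0//.
by rewrite lee_fin le_max lexx.
Qed.

Lemma Lp_bounded_operatorI (V W : normedModType R[i]) (A : (R -> V) -> (R -> W)) c :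
  0 <= c ->
  (forall f, strongly_measurable mu Rplus f -> (pow_integral f < +oo)%E ->
    strongly_measurable mu Rplus (A f) /\
    (pow_integral (A f) <= c%:E * pow_integral f)%E) ->
  (forall a f g, strongly_measurable mu Rplus f -> (pow_integral f < +oo)%E ->
    strongly_measurable mu Rplus g -> (pow_integral g < +oo)%E ->
    forall t, 0 <= t -> A (fun r => a *: f r + g r) t = a *: A f t + A g t) ->
  Lp_bounded_operator p A.
Proof.
move=> c0 AB Alin; split.
- move=> f /in_LpP[sf foo]; have [sAf Af] := AB f sf foo.
  apply/in_LpP; split; first exact: sAf.
  apply: (le_lt_trans Af).
  by rewrite -ge0_fin_numE ?mule_ge0 ?lee_fin ?pow_integral_ge0// fin_numM//
    ge0_fin_numE ?pow_integral_ge0.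
- move=> a f g /in_LpP[sf foo] /in_LpP[sg goo]; apply: aeW => t.
  by rewrite /Rplus/= in_itv/= andbT; exact: Alin.
- exists (c `^ p^-1) => f /in_LpP[sf foo]; have [_ Af] := AB f sf foo.
  rewrite !Lp_normE -poweR_EFin -poweRM ?lee_fin ?pow_integral_ge0//.
  rewrite gt0_ler_poweR ?invr_ge0 ?(ltW p0) ?in_itv/= ?leey ?andbT ?mule_ge0
    ?lee_fin ?pow_integral_ge0//.
Qed.

Lemma multiplication_bounded (V W : normedModType R[i]) (D : R -> V -> W) :
  Linfty_strong D -> exists2 c, 0 <= c & forall f, strongly_measurable mu Rplus f ->
    strongly_measurable mu Rplus (multiplication_op D f) /\
    (pow_integral (multiplication_op D f) <= c%:E * pow_integral f)%E.
Proof.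
move=> [bD sD [c Dc]]; exists (Num.max c 0 `^ p); first exact: powR_ge0.
move=> f sf; split.
  apply: strongly_measurable_mul => //; first exact: measurable_Rplus.
  by move=> t; rewrite /Rplus/= in_itv/= andbT; exact: bD.
apply: pow_integralZ => //; first by rewrite le_max lexx orbT.
have [N [mN N0 DN]] := Dc; exists N; split=> //; apply: subset_trans DN.
apply: subsetC => t /= h /h /(_ (f t)) /le_trans; apply.
by rewrite ler_wpM2r ?rnorm_ge0// le_max lexx.
Qed.

End PowerIntegral.

(** * Evolution families and the Green operator *)

Section RightContinuous.
Context {R : realType} {V : normedModType R[i]}.
Local Notation mu := (@lebesgue_measure R).

(** The fibres of a monotone map are intervals. *)
Lemma nondecreasing_nat_measurable (k : R -> nat) :
  {homo k : x y / x <= y >-> (x <= y)%N} -> nat_measurable k.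
Proof.
move=> ndk j; apply: is_interval_measurable => x y /= kx ky z /andP[xz zy].
by apply/eqP; rewrite eqn_leq -[X in (_ <= X)%N && _]ky -[X in _ && (X <= _)%N]kx !ndk.
Qed.

(* Sampling at the right end points of a mesh of width 1/(m+1) approximates a
   right continuous function by countably valued ones. *)
Lemma right_continuous_strongly_measurable (f : R -> V) :
  (forall t, 0 <= t -> forall u : nat -> R, (forall n, t < u n) ->
    u n @[n --> \oo] --> t -> f (u n) @[n --> \oo] --> f t) ->
  strongly_measurable mu Rplus f.
Proof.
move=> rcf; pose k m (t : R) := Num.truncn (t * m.+1%:R).
pose u m (t : R) := (k m t).+1%:R / m.+1%:R : R.
have mk m : nat_measurable (k m).
  by apply: nondecreasing_nat_measurable => x y xy; rewrite /k le_truncn// ler_wpM2r.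
apply: (@strongly_measurable_lim _ _ _ mu _ _ measurable_Rplus (fun m t => f (u m t))).
  move=> m; apply: strong_strongly_measurable; first exact: measurable_Rplus.
  apply: (@strong_glue _ _ _ _ (fun j => cst (f (j.+1%:R / m.+1%:R))) _ (mk m)).
  by move=> j; exact: strong_cst.
apply: aeW => t; rewrite /Rplus/= in_itv/= andbT => t0.
have ut m : t < u m t by rewrite /u ltr_pdivlMr// truncnS_gt.
apply: rcf => //; apply: (@squeeze_cvgr _ _ _ _ (cst t) (fun m => t + m.+1%:R^-1)).
- near=> m; rewrite /= ltW//= /u ler_pdivrMr// mulrDl mulVf// -natr1 lerD2r.
  by rewrite truncn_le// mulr_ge0.
- exact: cvg_cst.
- rewrite -[X in _ --> X]addr0; apply: cvgD; first exact: cvg_cst.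
  exact: cvg_harmonic.
Unshelve. all: by end_near. Qed.

End RightContinuous.

Section EvolutionFamily.
Context {R : realType} {X : normedModType R[i]}.
Local Notation mu := (@lebesgue_measure R).
Variables (UU : R -> R -> X -> X) (hUU : evolution_family UU).

Lemma evolution_cvg (t_ s_ : nat -> R) (t s : R) x :
  (forall n, 0 <= s_ n <= t_ n) -> 0 <= s <= t ->
  t_ n @[n --> \oo] --> t -> s_ n @[n --> \oo] --> s ->
  UU (t_ n) (s_ n) x @[n --> \oo] --> UU t s x.
Proof.
move=> st_ st ct cs; have [_ _ _ /(_ x) /subspace_continuousP /(_ (t, s) st)] := hUU.
move=> h; apply: cvg_trans h => B /= wB.
have : \forall n \near \oo, (fun q : R * R => [set q : R * R | 0 <= q.2 <= q.1] q -> B (UU q.1 q.2 x)) (t_ n, s_ n).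
  have [[P Q] [/= Pt Qs] PQ] := wB.
  near=> n; apply: (PQ (t_ n, s_ n)); split=> /=; near: n; first exact: ct.
  exact: cs.
by apply: filterS => n; apply; exact: st_.
Unshelve. all: by end_near. Qed.

(** The orbit is extended by 0 before time [s]. The jump at [s] leaves it right continuous, and
    inputs built from it linearly vanish before [s], as [Gop_from] demands. *)
Definition trajectory (s : R) (x : X) (t : R) := if s <= t then UU t s x else 0.

Lemma trajectory_strongly_measurable (s : R) x : 0 <= s ->
  strongly_measurable mu Rplus (trajectory s x).
Proof.
move=> s0; apply: right_continuous_strongly_measurable => t t0 u ut cu.
rewrite /trajectory; have [st|ts] := leP s t.
  rewrite (_ : (fun n => _) = (fun n => UU (u n) s x)).
    apply: evolution_cvg => //; [|by rewrite s0|exact: cvg_cst].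
    by move=> n; rewrite s0 (le_trans st)// ltW.
  by apply/funext => n; rewrite (le_trans st)// ltW.
apply: cvg_near_cst.
have /cvgrPdist_lt/(_ (s - t)) := cu; rewrite subr_gt0 => /(_ ts).
apply: filterS => n; rewrite ltr_norml => /andP[h _].
by case: leP => // su; exfalso; lra.
Qed.

Lemma evolution_strongly_measurable (t : R) x : 0 <= t ->
  strongly_measurable mu `[0, t] (fun s => UU t s x).
Proof.
(* The maximum keeps the pair of times admissible for [s > t], so [g] is right continuous on the
   whole half-line and agrees with the integrand on [[0, t]]. *)
move=> t0; pose g s := UU (Num.max t s) s x.
have sg : strongly_measurable mu Rplus g.
  apply: right_continuous_strongly_measurable => s s0 u us cu.
  apply: evolution_cvg => //.
  - by move=> n; rewrite le_max lexx orbT (le_trans s0)// ltW.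
  - by rewrite s0 le_max lexx orbT.
  - apply: (@squeeze_cvgr _ _ _ _ (cst (Num.max t s)) (fun n => Num.max t s + (u n - s))).
    + apply: nearW => n /=; have sun := us n.
      by have [h1|h1] := leP t s; have [h2|h2] := leP t (u n); apply/andP; split; lra.
    + exact: cvg_cst.
    + rewrite -[X in _ --> X]addr0 -(subrr s).
      apply: cvgD; first exact: cvg_cst.
      by apply: cvgB; [exact: cu|exact: cvg_cst].
apply: (@strongly_measurable_ext _ _ _ mu _ _ g).
  by move=> s /=; rewrite in_itv/= => /andP[s0 st]; rewrite /g; congr (UU _ s x); apply: max_l.
apply: strongly_measurable_subset sg => s /=; rewrite /Rplus/= !in_itv/=.
by case/andP=> ->.
Qed.

Definition locally_bochner_integrable (f : R -> X) := strongly_measurable mu Rplus f /\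
  forall t, (\int[mu]_(s in `[0%R, t]) (rnorm (f s))%:E < +oo)%E.

Lemma itv0_Rplus (t : R) : `[0, t]%classic `<=` Rplus.
Proof. by move=> s /=; rewrite /Rplus/= !in_itv/= => /andP[->]. Qed.

Lemma lebesgue_itv0_lty (t : R) : (mu `[0%R, t] < +oo)%E.
Proof. by rewrite lebesgue_measure_itv/=; case: ifP => // _; rewrite -EFinB ltey. Qed.

(** On a bounded interval the inequality y <= 1 + y^p, valid for y >= 0, takes the place of Hölder's
    inequality. *)
Lemma pow_integral_locally_bochner_integrable p (f : R -> X) : 1 <= p ->
  strongly_measurable mu Rplus f -> (pow_integral p f < +oo)%E -> locally_bochner_integrable f.
Proof.
move=> p1 sf foo; split=> // t.
have [phi [N [mphi phi0 mN N0 fphi]]] := strongly_measurable_pow sf.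
have mphip D : measurable_fun D (fun s => (phi s `^ p)%:E) by exact: measurable_pow.
apply: (@le_lt_trans _ _ (\int[mu]_(s in `[0%R, t]) (1%:E + (phi s `^ p)%:E))%E).
  apply: (@ae_ge0_le_lower_integral _ _ _ mu _ N) => //.
  - by move=> s _; rewrite lee_fin rnorm_ge0.
  - by move=> s _; rewrite -EFinD lee_fin addr_ge0// powR_ge0.
  - move=> s /=; rewrite in_itv/= => /andP[s0 _] Ns; rewrite fphi// -EFinD lee_fin.
    have [h|h] := leP (phi s) 1; first by rewrite (le_trans h)// lerDl powR_ge0.
    by rewrite (@le_trans _ _ (phi s `^ p))// ?lerDr// le1r_powR// ltW.
rewrite ge0_integralD//; last 2 first.
- by move=> s _; rewrite lee_fin powR_ge0.
- exact: mphip.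
apply: lte_add_pinfty.
  have -> := integral_cst mu (measurable_itv `[0%R, t]) 1.
  by rewrite mul1e lebesgue_itv0_lty.
apply: le_lt_trans foo; rewrite (pow_integral_rep p mN N0 phi0 fphi).
apply: ge0_subset_integral => //; first exact: measurable_Rplus.
- exact: mphip.
- by move=> s _; rewrite lee_fin powR_ge0.
- exact: itv0_Rplus.
Qed.

End EvolutionFamily.

Section DominatedConvergence.
Context d (T : measurableType d) {R : realType} (mu : {measure set T -> \bar R}).
Context {V : normedModType R[i]}.
Variables (E : set T) (mE : measurable E).

(** The representatives of the [h_ n] and of [f] have different exceptional sets. All are collected
    in a null set [M], and the norms are cut off to [E] minus [M], where scalar dominated
    convergence applies. *)
Lemma rnorm_dominated_cvg0 (h_ : nat -> T -> V) (f : T -> V) (c : R) : 0 <= c ->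
  (forall n, strongly_measurable mu E (h_ n)) -> strongly_measurable mu E f ->
  (\int[mu]_(t in E) (rnorm (f t))%:E < +oo)%E ->
  (forall n t, E t -> rnorm (h_ n t) <= c * rnorm (f t)) ->
  (forall t, E t -> h_ n t @[n --> \oo] --> 0) ->
  (\int[mu]_(t in E) (rnorm (h_ n t))%:E)%E @[n --> \oo] --> 0%E.
Proof.
move=> c0 sh /(strongly_measurableP mu mE)[f' [N' [sf mN' N'0 ff']]] foo hf hcvg.
have /choice[g_ gP] n := (strongly_measurableP mu mE (h_ n)).1 (sh n).
have {gP} /choice[N_ NP] := gP.
pose M := N' `|` \bigcup_n N_ n.
have mM : measurable M.
  by apply: measurableU => //; apply: bigcup_measurable => n _; case: (NP n).
have M0 : mu M = 0%E.
  apply: measure_negligible => //; apply: negligibleU; first by exists N'; split.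
  by apply: negligible_bigcup => n; case: (NP n) => _ mNn Nn0 _; exists (N_ n); split.
have hg n t : E t -> ~ M t -> h_ n t = g_ n t.
  move=> Et Mt; case: (NP n) => _ _ _; apply=> // Nt.
  by apply: Mt; right; exists n.
have fM t : E t -> ~ M t -> f t = f' t by move=> Et Mt; apply: ff' => // Nt; apply: Mt; left.
have mg (u : T -> V) : strong u -> measurable_fun E
    ((fun t => (rnorm (u t))%:E : \bar R) \_ (E `\` M)).
  move=> /strong_rnorm su; apply: measurable_funTS.
  apply/(measurable_restrictT _ _).1; first exact: measurableD.
  by apply/measurable_EFinP; exact: measurable_funTS.
have patch_eq (u v : T -> V) : (forall t, E t -> ~ M t -> u t = v t) ->
    (\int[mu]_(t in E) (rnorm (u t))%:E)%E =
    (\int[mu]_(t in E) ((fun t => (rnorm (v t))%:E : \bar R) \_ (E `\` M)) t)%E.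
  move=> uv; apply: (ae_ge0_eq_lower_integral mE mM M0).
  - by move=> t _; rewrite lee_fin rnorm_ge0.
  - by move=> t _; rewrite patchE; case: ifPn => // _; rewrite lee_fin rnorm_ge0.
  - by move=> t Et Mt; rewrite patchE mem_set// uv.
rewrite (_ : (fun n => _) = (fun n => \int[mu]_(t in E)
    ((fun t => (rnorm (g_ n t))%:E : \bar R) \_ (E `\` M)) t)%E); last first.
  by apply/funext => n; apply: patch_eq => t; exact: hg.
rewrite -(integral0 mu E).
apply: (@dominated_cvg _ _ _ _ _ mE _ _
   (fun t => (c%:E * ((fun t => (rnorm (f' t))%:E : \bar R) \_ (E `\` M)) t)%E)).
- by move=> n; apply: mg; case: (NP n).
- move=> t Et; rewrite (_ : (fun n => _) = (fun n => (if t \in E `\` M then rnorm (h_ n t) else 0)%:E)).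
    case: (t \in E `\` M); last exact: cvg_cst.
    apply: cvg_EFin; first exact: nearW.
    rewrite (_ : _ \o _ = (fun n => rnorm (h_ n t - 0))).
      by apply/cvg_rnormP; exact: hcvg.
    by apply/funext => n; rewrite /= subr0.
  apply/funext => n; rewrite patchE; case: ifPn => // /set_mem[_ Mt].
  by rewrite hg.
- by move=> t Et; rewrite patchE; case: ifPn.
- apply/integrableP; split; first by apply: measurable_funeM; exact: mg.
  rewrite (eq_integral (fun t => c%:E * ((fun t => (rnorm (f' t))%:E : \bar R) \_ (E `\` M)) t)%E); last first.
    move=> t _; rewrite gee0_abs// mule_ge0// patchE; case: ifPn => // _.
    by rewrite lee_fin rnorm_ge0.
  rewrite ge0_integralZl_EFin//; last 2 first.
  - by move=> t _; rewrite patchE; case: ifPn => // _; rewrite lee_fin rnorm_ge0.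
  - exact: mg.
  rewrite -(patch_eq f f' fM) lte_mul_pinfty//.
- move=> n t Et; rewrite !patchE; case: ifPn => [/set_mem[_ Mt]|_]; last first.
    by rewrite abse0 mule0.
  rewrite -hg// -fM// -EFinM gee0_abs; first by rewrite lee_fin; exact: hf.
  by rewrite lee_fin rnorm_ge0.
Qed.

End DominatedConvergence.

(** * Existence, linearity and measurability of the Green operator *)

Section GreenOperator.
Context {R : realType} {X : completeNormedModType R[i]}.
Local Notation mu := (@lebesgue_measure R).
Variables (UU : R -> R -> X -> X) (hUU : evolution_family UU).
Hypothesis (hb : exponentially_bounded UU).

Lemma exponentially_bounded_uniform (T : R) : exists2 c, 0 <= c &
  forall t s x, 0 <= s <= t -> t <= T -> rnorm (UU t s x) <= c * rnorm x.
Proof.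
have [M [w [M1 hM]]] := hb; have M0 : 0 <= M by rewrite (le_trans ler01).
exists (M * expR (`|w| * T)); first by rewrite mulr_ge0// expR_ge0.
move=> t s x st tT; apply: (le_trans (hM t s st x)).
rewrite ler_wpM2r ?rnorm_ge0// ler_wpM2l// ler_expR.
have /andP[s0 ts] := st.
apply: (@le_trans _ _ (`|w| * (t - s))).
  by rewrite ler_wpM2r ?subr_ge0// ler_norm.
by rewrite ler_wpM2l// lerBlDr (le_trans tT)// lerDl.
Qed.

Lemma evolution_linear t s : 0 <= s <= t -> linear (UU t s).
Proof. by move=> st; case: hUU => /(_ t s st)[]. Qed.

Lemma evolution0 t s : 0 <= s <= t -> UU t s 0 = 0.
Proof.
move=> st; have := evolution_linear st 1 0 0; rewrite !scale1r addr0.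
by move/eqP; rewrite -subr_eq subrr => /eqP.
Qed.

Lemma has_bochner_integral_evolution (f : R -> X) s t :
  locally_bochner_integrable f -> 0 <= s <= t ->
  exists v, has_bochner_integral mu `[s, t] (fun r => UU t r (f r)) v.
Proof.
move=> [sf foo] /andP[s0 st]; have t0 := le_trans s0 st.
have st0 : `[s, t]%classic `<=` `[0, t]%classic.
  by move=> r /=; rewrite !in_itv/= => /andP[sr ->]; rewrite (le_trans s0 sr).
have sf' : strongly_measurable mu `[s, t] f.
  by apply: strongly_measurable_subset sf => r /st0; exact: itv0_Rplus.
have [c c0 hc] := exponentially_bounded_uniform t.
apply: (has_bochner_integral_exists (mu := mu) (measurable_itv `[s, t])).
- apply: (@le_lt_trans _ _ (mu `[0, t]%classic)); last exact: lebesgue_itv0_lty.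
  by apply: le_measure; rewrite ?inE//; exact: measurable_itv.
- apply: strongly_measurable_mul => //.
    move=> x; have h := evolution_strongly_measurable hUU x t0.
    by apply: strongly_measurable_subset h.
  by move=> r /st0; rewrite /= in_itv/=; case: hUU => h _ _ _; exact: h.
(* The estimate for two functions is used with coefficient 0 on the second, which is again [f]. *)
- apply: (@le_lt_trans _ _ (c%:E * (\int[mu]_(r in `[s, t]) (rnorm (f r))%:E) +
      0%:E * (\int[mu]_(r in `[s, t]) (rnorm (f r))%:E))%E).
    apply: (le_integral_rnormD (mu := mu) (measurable_itv `[s, t]) c0 (lexx 0) sf' sf').
    apply: aeW => r /st0 /=; rewrite in_itv/= mul0r addr0 => rt; exact: hc.
  rewrite mul0e adde0 lte_mul_pinfty//.
  apply: le_lt_trans (foo t); rewrite [leLHS]integral_mkcond [leRHS]integral_mkcond.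
  apply: ge0_le_lower_integral => r _; rewrite !patchE.
    by case: ifPn => // _; rewrite lee_fin rnorm_ge0.
  case: (boolP (r \in `[s, t]%classic)) => [/set_mem/st0/mem_set -> //|_].
  by case: ifPn => // _; rewrite lee_fin rnorm_ge0.
Qed.

Lemma has_bochner_integral_Gop (f : R -> X) t : locally_bochner_integrable f -> 0 <= t ->
  has_bochner_integral mu `[0, t] (fun s => UU t s (f s)) (Gop UU f t).
Proof.
move=> lf t0; have t00 : (0 : R) <= 0 <= t by rewrite lexx.
have [v hv] := has_bochner_integral_evolution lf t00.
by rewrite /Gop (bochner_integralE (mu := mu) (measurable_itv `[0, t]) (lebesgue_itv0_lty t) hv).
Qed.

(** This links the integrals over [[s, t]] in stabilizability and detectability to the Green
    operator, which always integrates from 0. *)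
Lemma Gop_from (f : R -> X) s t : locally_bochner_integrable f -> 0 <= s <= t ->
  (forall r, 0 <= r < s -> f r = 0) ->
  Gop UU f t = bochner_integral mu `[s, t] (fun r => UU t r (f r)).
Proof.
move=> lf st f0; have [v hv] := has_bochner_integral_evolution lf st.
have /andP[s0 ts] := st; have t0 := le_trans s0 ts.
have st0 : `[s, t]%classic `<=` `[0, t]%classic.
  by move=> r /=; rewrite !in_itv/= => /andP[sr ->]; rewrite (le_trans s0 sr).
have fin : (mu `[s, t]%classic < +oo)%E.
  apply: (@le_lt_trans _ _ (mu `[0, t]%classic)); last exact: lebesgue_itv0_lty.
  by apply: le_measure; rewrite ?inE//; exact: measurable_itv.
rewrite (bochner_integralE (mu := mu) (measurable_itv `[s, t]) fin hv).
apply: (bochner_integralE (mu := mu) (measurable_itv `[0, t]) (lebesgue_itv0_lty t)).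
have := has_bochner_integral_patch (mu := mu) (measurable_itv `[s, t])
  (measurable_itv `[0, t]) st0 (lebesgue_itv0_lty t) hv.
apply: has_bochner_integral_ext => r; rewrite /= in_itv/= => /andP[r0 rt].
rewrite /patch; case: ifPn => [//|/negP h]; rewrite f0 ?evolution0 ?r0//=.
by rewrite ltNge; apply/negP => sr; apply: h; apply/mem_set; rewrite /= in_itv/= sr.
Qed.

Lemma Gop_scaleD (a : R[i]) (f g : R -> X) t : locally_bochner_integrable f ->
  locally_bochner_integrable g -> 0 <= t ->
  Gop UU (fun r => a *: f r + g r) t = a *: Gop UU f t + Gop UU g t.
Proof.
move=> lf lg t0.
apply: (bochner_integralE (mu := mu) (measurable_itv `[0, t]) (lebesgue_itv0_lty t)).
have := has_bochner_integral_scaleD (mu := mu) (measurable_itv `[0, t]) (lebesgue_itv0_lty t) a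
  (has_bochner_integral_Gop lf t0) (has_bochner_integral_Gop lg t0).
apply: has_bochner_integral_ext => s /=; rewrite in_itv/= => st.
by rewrite (evolution_linear st).
Qed.

Lemma rnorm_Gop M w (f : R -> X) t : 0 <= M -> exponential_bound UU M w -> locally_bochner_integrable f -> 0 <= t ->
  ((rnorm (Gop UU f t))%:E <=
    \int[mu]_(s in `[0%R, t]) (M * expR (w * (t - s)) * rnorm (f s))%:E)%E.
Proof.
move=> M0 hM lf t0.
apply: le_trans (rnorm_has_bochner_integral (mu := mu) (measurable_itv `[0, t]) (lebesgue_itv0_lty t)
  (has_bochner_integral_Gop lf t0)) _.
apply: ge0_le_lower_integral => s; first by rewrite lee_fin rnorm_ge0.
by rewrite /= in_itv/= => st; rewrite lee_fin; exact: hM.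
Qed.

(** [Gop UU f] is right continuous: for times decreasing to [t] the integrands, extended by 0 to one
    interval, converge pointwise and are dominated by a multiple of [f]. *)
Lemma Gop_strongly_measurable (f : R -> X) : locally_bochner_integrable f ->
  strongly_measurable mu Rplus (Gop UU f).
Proof.
move=> lf; apply: right_continuous_strongly_measurable => t t0 u' ut' cu'.
(* Dropping the first [N] terms keeps all times below [t + 1], which provides a common interval and
   a common bound on the operators. *)
have [N _ hN] : \forall n \near \oo, u' n <= t + 1.
  have /cvgrPdist_lt/(_ 1 ltr01) := cu'; apply: filterS => n.
  by rewrite ltr_norml => /andP[h _]; lra.
rewrite -(cvg_shiftn N); pose u n := u' (n + N)%N.
have cu : u n @[n --> \oo] --> t by rewrite /u (cvg_shiftn N).
have ut n : t < u n by exact: ut'.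
have uT n : u n <= t + 1 by apply: hN; rewrite /= leq_addl.
pose E := `[0, t + 1]%classic : set R.
have mE : measurable E by exact: measurable_itv.
have Efin := lebesgue_itv0_lty (t + 1).
pose W r := patch (fun=> 0) `[0, r] (fun s => UU r s (f s)).
have hW r : 0 <= r -> r <= t + 1 -> has_bochner_integral mu E (W r) (Gop UU f r).
  move=> r0 rT; apply: has_bochner_integral_patch => //.
    by move=> s; rewrite /E /= !in_itv/= => /andP[-> sr]/=; exact: le_trans rT.
  exact: has_bochner_integral_Gop.
have hWt : has_bochner_integral mu E (W t) (Gop UU f t) by apply: hW => //; rewrite lerDl.
have u0 n : 0 <= u n by rewrite (le_trans t0)// ltW.
have hWu n : has_bochner_integral mu E (W (u n)) (Gop UU f (u n)) by exact: hW.
have [c c0 hc] := exponentially_bounded_uniform (t + 1).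
have Wc r s : 0 <= r -> r <= t + 1 -> rnorm (W r s) <= c * rnorm (f s).
  move=> r0 rT; rewrite /W /patch; case: ifPn => [/set_mem|_].
    by rewrite /= in_itv/= => rs; exact: hc.
  by rewrite rnorm0 mulr_ge0// rnorm_ge0.
have Wcvg s : E s -> -1 *: W t s + W (u n) s @[n --> \oo] --> 0.
  rewrite /E /= in_itv/= => /andP[s0 _].
  rewrite -[X in _ --> X](addNr (W t s)); apply: cvgD.
    by rewrite scaleN1r; exact: cvg_cst.
  (* For [s <= t] both integrands are genuine and continuity of the family applies; for [s > t] the
     times [u n] eventually fall below [s] and both integrands are 0. Approaching [t] from the right
     puts the boundary point [s = t] into the first case. *)
  have [st|ts] := leP s t.
    have -> : W t s = UU t s (f s) by rewrite /W /patch mem_set//= in_itv/= s0.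
    rewrite (_ : (fun n => _) = (fun n => UU (u n) s (f s))); last first.
      apply/funext => n; rewrite /W /patch mem_set//= in_itv/= s0/=.
      by rewrite (le_trans st)// ltW.
    apply: evolution_cvg => //; [|by rewrite s0|exact: cvg_cst].
    by move=> n; rewrite s0 (le_trans st)// ltW.
  have W0 r : r < s -> W r s = 0.
    by move=> rs; rewrite /W /patch memNset//= in_itv/= s0/= leNgt rs.
  rewrite (W0 t ts); apply: cvg_near_cst.
  have /cvgrPdist_lt/(_ (s - t)) := cu; rewrite subr_gt0 => /(_ ts).
  by apply: filterS => n; rewrite ltr_norml => /andP[h _]; apply: W0; lra.
have sfE : strongly_measurable mu E f.
  by apply: strongly_measurable_subset lf.1; exact: itv0_Rplus.
have ht n := has_bochner_integral_scaleD (mu := mu) mE Efin (-1) hWt (hWu n).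
have lim0 : (\int[mu]_(s in E) (rnorm (-1 *: W t s + W (u n) s))%:E)%E @[n --> \oo] --> 0%E.
  apply: (rnorm_dominated_cvg0 (mu := mu) mE (f := f) (c := c + c)) => //.
  - by rewrite addr_ge0.
  - by move=> n; case: (ht n).
  - exact: lf.2.
  - move=> n s _; rewrite mulrDl (le_trans (rnormD _ _))// lerD//; last exact: Wc.
    by rewrite scaleN1r rnormN Wc// lerDl.
apply/cvg_rnormP.
suff : (rnorm (Gop UU f (u n) - Gop UU f t))%:E @[n --> \oo] --> 0%:E by move/fine_cvg.
apply: (squeeze_cvge _ (cvg_cst 0%E) lim0); apply: nearW => n.
rewrite lee_fin rnorm_ge0/= addrC -scaleN1r.
exact: (rnorm_has_bochner_integral (mu := mu) mE Efin (ht n)).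
Qed.

End GreenOperator.

Lemma lebesgue_measure_closed_itv {R : realType} (a b : R) : a <= b ->
  lebesgue_measure (`[a, b]%classic : set R) = (b - a)%:E.
Proof.
rewrite lebesgue_measure_itv/= lte_fin; case: ltgtP => // -> _.
by rewrite subrr.
Qed.

(** * Datko's theorem *)

Section TrajectoryIntegrals.
Context {R : realType} {X : normedModType R[i]}.
Local Notation mu := (@lebesgue_measure R).
Variables (UU : R -> R -> X -> X) (hUU : evolution_family UU).
Variables (p : R) (p1 : 1 <= p).

Let p0 : 0 < p. Proof. exact: lt_le_trans p1. Qed.

Lemma exponentially_stable_bounded : exponentially_stable UU -> exponentially_bounded UU.
Proof. by move=> [M [w [M1 _ hM]]]; exists M, w. Qed.

Lemma exponentially_stable_trajectory : exponentially_stable UU ->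
  exists2 c, 0 <= c & forall s x, 0 <= s ->
    (pow_integral p (trajectory UU s x) <= (c * rnorm x `^ p)%:E)%E.
Proof.
move=> [M [w [M1 w0 hM]]]; have M0 : 0 < M by rewrite (lt_le_trans ltr01).
have pw0 : 0 < p * - w by rewrite mulr_gt0// oppr_gt0.
(* The p-th power of the exponential bound decays at rate [p * - w], and its tail integral is the
   inverse of that rate. *)
exists (M `^ p * (p * - w)^-1); first by rewrite mulr_ge0 ?powR_ge0// invr_ge0 ltW.
move=> s x s0; rewrite [leRHS](_ : _ = (M `^ p * rnorm x `^ p)%:E *
    \int[mu]_(t in `[s, +oo[) (expR (- (p * - w) * (t - s)))%:E)%E; last first.
  by rewrite (integral_expR_tail pw0) -EFinM mulrAC.
rewrite -ge0_integralZl_EFin//; last 2 first.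
- apply/measurable_EFinP; apply: measurable_funTS.
  apply: measurableT_comp => //; apply: measurable_funM => //.
  exact: measurable_funB.
- by rewrite mulr_ge0// powR_ge0.
rewrite /pow_integral [leLHS]integral_mkcond [leRHS]integral_mkcond.
apply: ge0_le_lower_integral => t _; rewrite !patchE.
  by case: ifPn => // _; rewrite lee_fin powR_ge0.
rewrite /trajectory; have [st|ts] := leP s t; last first.
  rewrite [X in (_ <= X)%E](_ : _ = 0%E).
    by case: ifPn => // _; rewrite rnorm0 powR0// gt_eqF.
  by rewrite memNset//= in_itv/= andbT; apply/negP; rewrite -ltNge.
rewrite !mem_set/=; last 2 first.
- by rewrite in_itv/= st.
- by rewrite /Rplus/= in_itv/= (le_trans s0).
rewrite -EFinM lee_fin -powRM ?rnorm_ge0 ?(ltW M0)//.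
rewrite [X in _ * expR X](_ : _ = (w * (t - s)) * p); last by ring.
rewrite expRM -powRM ?mulr_ge0 ?rnorm_ge0 ?expR_ge0 ?(ltW M0)//.
apply: ge0_ler_powR; rewrite ?nnegrE ?rnorm_ge0 ?mulr_ge0 ?rnorm_ge0 ?expR_ge0 ?(ltW M0) ?(ltW p0)//.
by rewrite mulrAC; apply: hM; rewrite s0.
Qed.

Section Datko.
Hypothesis (hb : exponentially_bounded UU).
Variable (K : R).
Hypothesis (K0 : 0 <= K).
Hypothesis (hK : forall s x, 0 <= s ->
  (pow_integral p (trajectory UU s x) <= (K * rnorm x `^ p)%:E)%E).

Let k := K `^ p^-1.
Let k0 : 0 <= k. Proof. exact: powR_ge0. Qed.
Let kp : k `^ p = K.
Proof. by rewrite /k -powRrM mulVf ?powRr1// gt_eqF. Qed.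

Let powR_le (a b : R) : 0 <= a -> 0 <= b -> a `^ p <= b `^ p -> a <= b.
Proof.
move=> a0 b0; apply: contraTT; rewrite -!ltNge => ba.
by apply: gt0_ltr_powR => //; rewrite nnegrE.
Qed.

(** A Chebyshev estimate: an orbit that stays above [v] on [[a, b]] has p-th power integral at least
    (b - a) v^p, while [hK] bounds that integral from above. *)
Lemma trajectory_lower_bound (s a b v : R) x : 0 <= s -> s <= a -> a <= b -> 0 <= v ->
  (forall r, a <= r <= b -> v <= rnorm (UU r s x)) ->
  (b - a) * v `^ p <= (k * rnorm x) `^ p.
Proof.
move=> s0 sa ab v0 hv; rewrite powRM ?rnorm_ge0// kp -lee_fin.
apply: le_trans (hK x s0).
apply: (@le_trans _ _ (\int[mu]_(r in `[a, b]) (v `^ p)%:E)%E).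
  have -> := integral_cst mu (measurable_itv `[a, b]) (v `^ p)%:E.
  have /= -> := lebesgue_measure_closed_itv ab.
  by rewrite -EFinM mulrC.
rewrite [leLHS]integral_mkcond /pow_integral [leRHS]integral_mkcond.
apply: ge0_le_lower_integral => r _; rewrite !patchE.
  by case: ifPn => // _; rewrite lee_fin powR_ge0.
case: ifPn => [/set_mem|_]; last first.
  by case: ifPn => // _; rewrite lee_fin powR_ge0.
rewrite /= in_itv/= => /[dup] rab /andP[ar rb].
rewrite mem_set; last by rewrite /Rplus/= in_itv/= (le_trans s0)// (le_trans sa).
rewrite /trajectory (le_trans sa ar) lee_fin.
by apply: ge0_ler_powR; rewrite ?nnegrE ?rnorm_ge0 ?(ltW p0)//; exact: hv.
Qed.

Let local_bound : exists2 L0, 1 <= L0 &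
  forall t s x, 0 <= s <= t -> t <= s + 1 -> rnorm (UU t s x) <= L0 * rnorm x.
Proof.
have [M [w [M1 hM]]] := hb; exists (M * expR `|w|).
  by rewrite -[leLHS]mulr1 ler_pM// -expR0 ler_expR.
move=> t s x st ts; apply: (le_trans (hM t s st x)).
rewrite ler_wpM2r ?rnorm_ge0// ler_wpM2l ?(le_trans ler01)// ler_expR.
have /andP[s0 st'] := st.
apply: (@le_trans _ _ (`|w| * (t - s))).
  by rewrite ler_wpM2r ?subr_ge0// ler_norm.
by rewrite ler_piMr// lerBlDl.
Qed.

Let evolutionM t r s x : 0 <= s -> s <= r -> r <= t -> UU t s x = UU t r (UU r s x).
Proof. by move=> s0 sr rt; case: hUU => _ h _ _; exact: h. Qed.

(** If [UU t s x] is large, the orbit was already large throughout [[t - 1, t]], since one unit of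
    time multiplies norms by at most [L0]. The Chebyshev estimate on that unit interval then bounds
    [rnorm (UU t s x) / L0] by [k * rnorm x]. *)
Let uniform_bound : exists2 L, 1 <= L &
  forall t s x, 0 <= s <= t -> rnorm (UU t s x) <= L * rnorm x.
Proof.
have [L0 L01 hL0] := local_bound; have L00 : 0 < L0 by rewrite (lt_le_trans ltr01).
exists (L0 * (1 + k)); first by rewrite -[leLHS]mulr1 ler_pM// lerDl.
move=> t s x /andP[s0 st].
have [ts|ts] := leP t (s + 1).
  rewrite (le_trans (hL0 t s x _ ts)) ?s0//.
  by rewrite ler_wpM2r ?rnorm_ge0// ler_peMr ?(ltW L00)// lerDl.
have := @trajectory_lower_bound s (t - 1) t (rnorm (UU t s x) / L0) x s0.
have -> : t - (t - 1) = 1 by ring.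
rewrite mul1r => h.
have {}h : rnorm (UU t s x) / L0 <= k * rnorm x.
  apply: powR_le; rewrite ?divr_ge0 ?mulr_ge0 ?rnorm_ge0 ?(ltW L00)//.
  apply: h; rewrite ?divr_ge0 ?rnorm_ge0 ?(ltW L00)//; [lra|lra|].
  move=> r /andP[tr rt]; rewrite ler_pdivrMr// mulrC.
  rewrite (@evolutionM t r)//; last lra.
  by apply: hL0; lra.
rewrite ler_pdivrMr// in h; rewrite (le_trans h)// mulrAC ler_wpM2r ?rnorm_ge0//.
by rewrite mulrC ler_wpM2l ?(ltW L00)// lerDr.
Qed.

(* Datko's argument: the orbits are bounded, hence so is (t - s) |U(t,s)x|^p, and
   U(t,s) is a contraction by a fixed factor once t - s is large. *)
Lemma datko : exponentially_stable UU.
Proof.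
have [L L1 hL] := uniform_bound; have L0 : 0 < L by rewrite (lt_le_trans ltr01).
(* This length makes the contraction factor over time [T] equal to 1/e; the added 1 keeps [T]
   positive even if [k = 0]. *)
pose T := (k * L * expR 1) `^ p + 1.
have T0 : 0 < T by rewrite ltr_wpDl// powR_ge0.
have e0 : 0 < expR 1 :> R by exact: expR_gt0.
have contr s x : 0 <= s -> rnorm (UU (s + T) s x) <= expR (-1) * rnorm x.
  move=> s0; set v := rnorm (UU (s + T) s x) / L.
  have v0 : 0 <= v by rewrite divr_ge0 ?rnorm_ge0// ltW.
  have := @trajectory_lower_bound s s (s + T) v x s0 (lexx s) _ v0.
  rewrite lerDl (ltW T0) => /(_ isT) h.
  have {}h : T * v `^ p <= (k * rnorm x) `^ p.
    move: h; rewrite addrAC subrr add0r; apply => r /andP[sr rT].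
    rewrite ler_pdivrMr// mulrC (@evolutionM (s + T) r)//.
    by apply: hL; rewrite rT (le_trans s0).
  have Lv : L * v = rnorm (UU (s + T) s x) by rewrite /v mulrC divfK// gt_eqF.
  have Le0 : 0 <= L * expR 1 by rewrite mulr_ge0 ?(ltW L0) ?(ltW e0).
  have kLe0 : 0 <= k * L * expR 1 by rewrite -mulrA mulr_ge0.
  have kx0 : 0 <= k * rnorm x by rewrite mulr_ge0 ?rnorm_ge0.
  (* Multiplied by [T], the p-th power of the left side is bounded through [h] by (k L e)^p times
     that of [rnorm x], and [T] exceeds (k L e)^p. *)
  have : L * v * expR 1 <= rnorm x.
    rewrite mulrAC; apply: powR_le; [exact: mulr_ge0|exact: rnorm_ge0|].
    rewrite -(ler_pM2l T0) powRM// mulrCA.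
    apply: (@le_trans _ _ ((L * expR 1) `^ p * (k * rnorm x) `^ p)).
      by rewrite ler_wpM2l// powR_ge0.
    rewrite -powRM//.
    rewrite (_ : L * expR 1 * (k * rnorm x) = (k * L * expR 1) * rnorm x); last by ring.
    rewrite powRM ?rnorm_ge0//.
    by rewrite ler_wpM2r ?powR_ge0// /T lerDl.
  rewrite Lv => hx; rewrite expRN mulrC ler_pdivlMr//.
have iter n s t x : 0 <= s -> s + n%:R * T <= t ->
    rnorm (UU t s x) <= L * expR (- n%:R) * rnorm x.
  elim: n s x => [|n IH] s x s0 st.
    by rewrite oppr0 expR0 mulr1; apply: hL; move: st; rewrite mul0r addr0 s0.
  have nT : 0 <= n%:R * T by rewrite mulr_ge0// ltW.
  have st' : s + T + n%:R * T <= t by move: st; rewrite -natr1 mulrDl mul1r; lra.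
  rewrite (@evolutionM t (s + T)) ?lerDl ?(ltW T0)//; last lra.
  apply: (le_trans (IH (s + T) _ _ st')); first by rewrite addr_ge0// ltW.
  rewrite -natr1 opprD expRD -!mulrA ler_wpM2l ?(ltW L0)// ler_wpM2l ?expR_ge0//.
  exact: contr.
(* With n the integer part of (t - s)/T, the decay e^(-n) is at most e times e^(-(t-s)/T); this loss
   is the factor [expR 1]. *)
exists (L * expR 1), (- T^-1); split.
- by rewrite -[leLHS]mulr1 ler_pM// -expR0 ler_expR.
- by rewrite oppr_lt0 invr_gt0.
- move=> t s /andP[s0 st] x; pose n := Num.truncn ((t - s) / T).
  have ts0 : 0 <= (t - s) / T by rewrite divr_ge0 ?subr_ge0// ltW.
  apply: (le_trans (iter n s t x s0 _)).
    by rewrite -lerBrDl -ler_pdivlMr// truncn_le.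
  rewrite ler_wpM2r ?rnorm_ge0// -mulrA ler_wpM2l ?(ltW L0)// -expRD ler_expR.
  have := truncnS_gt ((t - s) / T); rewrite -/n -natr1 mulNr [T^-1 * _]mulrC; lra.
Qed.

End Datko.
End TrajectoryIntegrals.

Section StableGreenOperator.
Context {R : realType} {X : completeNormedModType R[i]}.
Local Notation mu := (@lebesgue_measure R).
Variables (UU : R -> R -> X -> X) (hUU : evolution_family UU).
Variables (p : R) (p1 : 1 <= p).

(** At each fixed time Jensen's inequality moves the p-th power inside the integral; integrating
    over time and exchanging the order by Tonelli finishes. Only scalar integrals are exchanged. *)
Lemma Gop_pow_integral : exponentially_stable UU -> exists2 c, 0 <= c & forall f,
  strongly_measurable mu Rplus f -> (pow_integral p f < +oo)%E ->
  strongly_measurable mu Rplus (Gop UU f) /\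
  (pow_integral p (Gop UU f) <= c%:E * pow_integral p f)%E.
Proof.
move=> st; have hb := exponentially_stable_bounded st.
have [M [w [M1 w0 hM]]] := st; have M0 : 0 < M by rewrite (lt_le_trans ltr01).
have nu0 : 0 < - w by rewrite oppr_gt0.
have K0 : 0 < (- w)^-1 by rewrite invr_gt0.
(* [M] comes from the exponential bound and the other factor from Jensen's inequality with mass
   [(- w)^-1]. Tonelli adds one more factor [(- w)^-1], for a total of (M / -w)^p. *)
pose c1 := M `^ p * (- w)^-1 `^ (p - 1).
have c10 : 0 <= c1 by rewrite mulr_ge0// powR_ge0.
exists (c1 * (- w)^-1); first by rewrite mulr_ge0// ltW.
move=> f sf foo.
have lf := pow_integral_locally_bochner_integrable p1 sf foo.
split; first exact: Gop_strongly_measurable.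
have [phi [N [mphi phi0 mN N0 fphi]]] := strongly_measurable_pow sf.
have mphip : measurable_fun setT (fun s => phi s `^ p).
  exact: (measurableT_comp (measurable_powR p)).
have phip0 s : 0 <= phi s `^ p by exact: powR_ge0.
pose kk (t s : R) : R := expR (- (- w) * (t - s)).
have mkk t : measurable_fun setT (kk t).
  apply: measurableT_comp => //; apply: measurable_funM => //.
  exact: measurable_funB.
have key t : 0 <= t -> ((rnorm (Gop UU f t) `^ p)%:E <=
    c1%:E * \int[mu]_(s in `[0%R, t]) (kk t s * phi s `^ p)%:E)%E.
  move=> t0; pose y := rnorm (Gop UU f t) / M.
  have y0 : 0 <= y by rewrite divr_ge0 ?rnorm_ge0// ltW.
  have yM : rnorm (Gop UU f t) = M * y by rewrite /y mulrC divfK// gt_eqF.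
  have hy : (y%:E <= \int[mu]_(s in `[0%R, t]) (kk t s * phi s)%:E)%E.
    rewrite -(@lee_pmul2l _ M%:E)// -EFinM -yM.
    apply: (le_trans (rnorm_Gop hUU hb (ltW M0) hM lf t0)).
    rewrite -ge0_integralZl_EFin//; last 3 first.
    - by move=> s _; rewrite lee_fin mulr_ge0// expR_ge0.
    - apply/measurable_EFinP; apply: measurable_funTS.
      exact: (measurable_funM (mkk t) mphi).
    - exact: ltW.
    apply: (@ae_ge0_le_lower_integral _ _ _ mu _ N) => //.
    - by move=> s _; rewrite lee_fin !mulr_ge0 ?rnorm_ge0 ?expR_ge0 ?(ltW M0).
    - by move=> s _; rewrite -EFinM lee_fin !mulr_ge0 ?expR_ge0 ?(ltW M0).
    - move=> s; rewrite /= in_itv/= => /andP[s0 _] Ns.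
      by rewrite fphi// -EFinM lee_fin -mulrA /kk opprK.
  rewrite yM powRM ?(ltW M0)// EFinM /c1 EFinM -muleA lee_wpmul2l ?lee_fin ?powR_ge0//.
  apply: (jensen_powR (mu := mu) (measurable_itv `[0, t]) _ _ _ _ p1 K0 y0 _ hy) => //.
  - by apply: measurable_funTS; exact: mkk.
  - by apply: measurable_funTS; exact: mphi.
  - by move=> s; exact: expR_ge0.
  - exact: integral_expR_head.
apply: (@le_trans _ _ (\int[mu]_(t in Rplus)
    (c1%:E * \int[mu]_(s in `[0%R, t]) (kk t s * phi s `^ p)%:E))%E).
  apply: ge0_le_lower_integral => t; first by rewrite lee_fin powR_ge0.
  by rewrite /Rplus/= in_itv/= andbT; exact: key.
rewrite ge0_integralZl_EFin//; last 3 first.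
- exact: measurable_Rplus.
- move=> t _; apply: integral_ge0 => s _; rewrite lee_fin mulr_ge0//; exact: expR_ge0.
- exact: (measurable_expR_convolution (- w) mphip phip0).
rewrite [leRHS](_ : _ = c1%:E * (((- w)^-1)%:E * pow_integral p f))%E; last first.
  by rewrite muleA -EFinM.
apply: lee_wpmul2l; first by rewrite lee_fin.
rewrite (pow_integral_rep p mN N0 phi0 fphi).
exact: (integral_expR_convolution nu0 mphip phip0).
Qed.

End StableGreenOperator.

(** * Orbit segments of length one as inputs of the Green operator *)

Section InitialSegment.
Context {R : realType} {X : completeNormedModType R[i]}.
Local Notation mu := (@lebesgue_measure R).
Variables (UU : R -> R -> X -> X) (hUU : evolution_family UU).
Hypothesis (hb : exponentially_bounded UU).
Variables (p : R) (p1 : 1 <= p).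

Definition initial_trajectory (s : R) (x : X) : R -> X :=
  patch (fun=> 0) `[s, s + 1] (trajectory UU s x).

Lemma initial_trajectory_strongly_measurable s x : 0 <= s ->
  strongly_measurable mu Rplus (initial_trajectory s x).
Proof.
move=> s0; apply: strongly_measurable_patch => //; first exact: measurable_Rplus.
have h := trajectory_strongly_measurable hUU x s0.
apply: strongly_measurable_subset h => t; rewrite /Rplus/= !in_itv/= andbT => /andP[st _].
exact: le_trans st.
Qed.

Lemma initial_trajectory_pow_integral : exists2 c, 0 <= c & forall s x, 0 <= s ->
  (pow_integral p (initial_trajectory s x) <= (c * rnorm x `^ p)%:E)%E.
Proof.
have [M [w [M1 hM]]] := hb; have M0 : 0 < M by rewrite (lt_le_trans ltr01).
have p0 : 0 < p by rewrite (lt_le_trans ltr01).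
exists ((M * expR `|w|) `^ p); first exact: powR_ge0.
move=> s x s0.
have c0 : 0 <= M * expR `|w| by rewrite mulr_ge0 ?expR_ge0// ltW.
have ss : s <= s + 1 by rewrite lerDl.
apply: (@le_trans _ _ (\int[mu]_(t in `[s, (s + 1)%R])
    ((M * expR `|w|) `^ p * rnorm x `^ p)%:E)%E); last first.
  have -> := integral_cst mu (measurable_itv `[s, s + 1]) ((M * expR `|w|) `^ p * rnorm x `^ p)%:E.
  have /= -> := lebesgue_measure_closed_itv ss.
  by rewrite addrAC subrr add0r mule1.
rewrite /pow_integral [leLHS]integral_mkcond [leRHS]integral_mkcond.
apply: ge0_le_lower_integral => t _; rewrite !patchE.
  by case: ifPn => // _; rewrite lee_fin powR_ge0.
rewrite /initial_trajectory /patch.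
case: (boolP (t \in `[s, s + 1]%classic)) => [/set_mem|_]; last first.
  by case: ifPn => // _; rewrite rnorm0 powR0// gt_eqF.
rewrite /= in_itv/= => /andP[st ts1].
rewrite mem_set; last by rewrite /Rplus/= in_itv/= (le_trans s0).
rewrite /trajectory st lee_fin -powRM ?rnorm_ge0//.
apply: ge0_ler_powR; rewrite ?nnegrE ?rnorm_ge0 ?(ltW p0)//.
  by rewrite mulr_ge0 ?rnorm_ge0.
apply: le_trans (hM t s _ x) _; first by rewrite s0.
rewrite ler_wpM2r ?rnorm_ge0// ler_wpM2l ?(ltW M0)// ler_expR.
apply: (@le_trans _ _ (`|w| * (t - s))).
  by rewrite ler_wpM2r ?subr_ge0// ler_norm.
by rewrite ler_piMr// lerBlDl.
Qed.

(** By the cocycle identity the integrand is the constant [UU t s x] on an interval of length one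
    and 0 elsewhere; choosing length one removes any normalizing factor. *)
Lemma Gop_initial_trajectory s t x : 0 <= s -> s + 1 <= t ->
  Gop UU (initial_trajectory s x) t = UU t s x.
Proof.
move=> s0 st; pose A := `[s, s + 1]%classic : set R.
have ss : s <= s + 1 by rewrite lerDl.
apply: (bochner_integralE (mu := mu) (measurable_itv `[0, t]) (lebesgue_itv0_lty t)).
have := has_bochner_integral_cst (mu := mu) (measurable_itv `[0, t])
  (lebesgue_itv0_lty t) (A := A) (UU t s x) (measurable_itv _).
have /= -> := lebesgue_measure_closed_itv ss.
rewrite addrAC subrr add0r scale1r => /(_ _ _)/has_bochner_integral_ext; apply.
- move=> r; rewrite /= in_itv/= => /andP[r0 rt].
  rewrite /initial_trajectory /patch; case: ifPn => [/set_mem|_]; last first.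
    by rewrite (evolution0 hUU)// r0.
  rewrite /A /= in_itv/= => /andP[sr _]; rewrite /trajectory sr.
  by case: hUU => _ h _ _; exact: h.
- by move=> r; rewrite /A /= !in_itv/= => /andP[sr rs]; rewrite (le_trans s0)// (le_trans rs).
- by exists s; rewrite /A /= in_itv/= lexx.
Qed.

End InitialSegment.

(** * Stabilizability and detectability *)

Section UniformlyLp.
Context {R : realType} (p : R) (p1 : 1 <= p) (X : completeNormedModType R[i]).
Local Notation mu := (@lebesgue_measure R).

(** For [trajectory UU] this supplies the integral bound of [datko]. Stating it for any family
    indexed by initial data makes it pass through bounded operators, so that each condition reduces
    to a chain of such steps. *)
Definition uniformly_Lp (V : normedModType R[i]) (G : R -> X -> R -> V) : Prop :=
  exists2 K, 0 <= K & forall s x, 0 <= s -> strongly_measurable mu Rplus (G s x) /\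
    (pow_integral p (G s x) <= (K * rnorm x `^ p)%:E)%E.

Lemma uniformly_Lp_op (V W : normedModType R[i]) (A : (R -> V) -> (R -> W)) c
    (G : R -> X -> R -> V) : 0 <= c ->
  (forall f, strongly_measurable mu Rplus f -> (pow_integral p f < +oo)%E ->
    strongly_measurable mu Rplus (A f) /\
    (pow_integral p (A f) <= c%:E * pow_integral p f)%E) ->
  uniformly_Lp G -> uniformly_Lp (fun s x => A (G s x)).
Proof.
move=> c0 hA [K K0 hK]; exists (c * K); first exact: mulr_ge0.
move=> s x s0; have [sG GK] := hK s x s0.
have [sA AG] := hA _ sG (le_lt_trans GK (ltry _)); split=> //.
apply: (le_trans AG); rewrite -mulrA EFinM.
by apply: lee_wpmul2l; rewrite ?lee_fin.
Qed.

Lemma uniformly_Lp_bounded_op (V W : normedModType R[i]) (A : (R -> V) -> (R -> W))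
    (G : R -> X -> R -> V) :
  Lp_bounded_operator p A -> uniformly_Lp G -> uniformly_Lp (fun s x => A (G s x)).
Proof. by move=> /(Lp_bounded_operatorE p1)[c c0 hA]; exact: uniformly_Lp_op hA. Qed.

Lemma uniformly_Lp_mul (V W : normedModType R[i]) (D : R -> V -> W)
    (G : R -> X -> R -> V) :
  Linfty_strong D -> uniformly_Lp G ->
  uniformly_Lp (fun s x => multiplication_op D (G s x)).
Proof.
move=> /(multiplication_bounded p1)[c c0 hD].
by apply: uniformly_Lp_op c0 _ => f sf _; exact: hD.
Qed.

(** A pointwise bound on norms says nothing about measurability, so that of [I] is required
    separately. *)
Lemma uniformly_Lp_le (V1 V2 V3 : normedModType R[i]) (G : R -> X -> R -> V1)
    (H : R -> X -> R -> V2) (I : R -> X -> R -> V3) :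
  uniformly_Lp G -> uniformly_Lp H ->
  (forall s x, 0 <= s -> strongly_measurable mu Rplus (I s x)) ->
  (forall s x t, 0 <= s -> 0 <= t -> rnorm (I s x t) <= rnorm (G s x t) + rnorm (H s x t)) ->
  uniformly_Lp I.
Proof.
move=> [K K0 hK] [L L0 hL] sI IGH; exists (2 `^ p * (K + L)).
  by rewrite mulr_ge0 ?powR_ge0// addr_ge0.
move=> s x s0; split; first exact: sI.
have [sG GK] := hK s x s0; have [sH HL] := hL s x s0.
apply: (le_trans (pow_integralD p1 sG sH (fun t => IGH s x t s0))).
rewrite -mulrA EFinM; apply: lee_wpmul2l; first by rewrite lee_fin powR_ge0.
by rewrite mulrDl EFinD leeD.
Qed.

Lemma uniformly_Lp_lty (V : normedModType R[i]) (G : R -> X -> R -> V) s x :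
  uniformly_Lp G -> 0 <= s ->
  strongly_measurable mu Rplus (G s x) /\ (pow_integral p (G s x) < +oo)%E.
Proof.
move=> [K _ hK] /(hK s x)[sG GK]; split=> //; exact: le_lt_trans GK (ltry _).
Qed.

Lemma uniformly_Lp_stable UU : evolution_family UU -> exponentially_stable UU ->
  uniformly_Lp (trajectory UU).
Proof.
move=> hUU /(exponentially_stable_trajectory p1)[c c0 hc]; exists c => // s x s0.
by split; [exact: trajectory_strongly_measurable|exact: hc].
Qed.

Lemma uniformly_Lp_initial UU : evolution_family UU -> exponentially_bounded UU ->
  uniformly_Lp (initial_trajectory UU).
Proof.
move=> hUU hb; have [c c0 hc] := initial_trajectory_pow_integral hb p1; exists c => // s x s0.
by split; [exact: initial_trajectory_strongly_measurable|exact: hc].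
Qed.

Lemma uniformly_Lp_datko UU : evolution_family UU -> exponentially_bounded UU ->
  uniformly_Lp (trajectory UU) -> exponentially_stable UU.
Proof.
move=> hUU hb [K K0 hK]; apply: (datko hUU p1 hb K0) => s x s0.
by case: (hK s x s0).
Qed.

(** Before time [s] both sides are 0, so the left end of the cut-off interval is invisible. *)
Lemma initial_trajectoryE (UU : R -> R -> X -> X) s x t : t <= s + 1 ->
  initial_trajectory UU s x t = trajectory UU s x t.
Proof.
move=> ts; rewrite /initial_trajectory /patch; case: ifPn => // /negP h.
rewrite /trajectory; case: ifPn => // st; exfalso.
by apply: h; apply/mem_set; rewrite /= in_itv/= st.
Qed.

End UniformlyLp.

Section Feedback.
Context {R : realType}.
Local Notation mu := (@lebesgue_measure R).

Lemma Linfty_strong_linear (V W : normedModType R[i]) (D : R -> V -> W) t :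
  Linfty_strong D -> 0 <= t -> linear (D t).
Proof. by move=> [h _ _] /h[]. Qed.

Lemma Linfty_strong0 (V W : normedModType R[i]) (D : R -> V -> W) t :
  Linfty_strong D -> 0 <= t -> D t 0 = 0.
Proof.
move=> hD t0; have := Linfty_strong_linear hD t0 1 0 0; rewrite !scale1r addr0.
by move/eqP; rewrite -subr_eq subrr => /eqP.
Qed.

Lemma Linfty_strongB (V W : normedModType R[i]) (D : R -> V -> W) t x y :
  Linfty_strong D -> 0 <= t -> D t (x - y) = D t x - D t y.
Proof.
move=> hD t0; have := Linfty_strong_linear hD t0 (-1) y x.
by rewrite !scaleN1r ![- _ + _]addrC.
Qed.

Lemma bochner_integral_ext (V : normedModType R[i]) (E : set R) (f g : R -> V) :
  (forall t, E t -> f t = g t) -> bochner_integral mu E f = bochner_integral mu E g.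
Proof.
move=> fg; rewrite /bochner_integral; congr xget; apply/seteqP; split=> v /=.
  exact: has_bochner_integral_ext.
by apply: has_bochner_integral_ext => t /fg.
Qed.

(* The value is [0] by convention if the integral does not exist. *)
Lemma bochner_integral_eq0 (V : normedModType R[i]) (a b : R) (f : R -> V) : 0 <= a ->
  (forall t, a <= t <= b -> f t = 0) -> bochner_integral mu `[a, b] f = 0.
Proof.
move=> a0 f0; rewrite (@bochner_integral_ext _ _ _ (fun=> 0)); last first.
  by move=> t; rewrite /= in_itv/=; exact: f0.
rewrite /bochner_integral; case: xgetP => // v _ /= hv.
have fin : (mu `[a, b]%classic < +oo)%E.
  apply: (@le_lt_trans _ _ (mu `[0, b]%classic)); last exact: lebesgue_itv0_lty.
  apply: le_measure; rewrite ?inE//; try exact: measurable_itv.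
  by move=> t; rewrite /= !in_itv/= => /andP[at' ->]; rewrite (le_trans a0).
have := rnorm_has_bochner_integral (mu := mu) (measurable_itv `[a, b]) fin hv.
rewrite integral0_eq; last by move=> t _; rewrite rnorm0.
by rewrite lee_fin => h; apply: rnorm0_eq0; apply/le_anti; rewrite h rnorm_ge0.
Qed.

Lemma Linfty_strong_zero (V W : normedModType R[i]) : Linfty_strong (fun (_ : R) (_ : V) => 0 : W).
Proof.
split.
- move=> t _; split; first by move=> a x y; rewrite scaler0 addr0.
  by exists 0 => x; rewrite rnorm0 mul0r.
- by move=> v; apply: strong_strongly_measurable; [exact: measurable_Rplus|exact: strong_cst].
- by exists 0; apply: aeW => t _ x; rewrite rnorm0 mul0r.
Qed.

Variables (X U Y : completeNormedModType R[i]) (p : R) (p1 : 1 <= p).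
Variables (UU : R -> R -> X -> X) (hUU : evolution_family UU).
Hypothesis (hUUb : exponentially_bounded UU).

Lemma stabilized_trajectory (B : R -> U -> X) (F : R -> X -> U) (UBF : R -> R -> X -> X) :
  Linfty_strong B -> Linfty_strong F -> evolution_family UBF -> exponentially_stable UBF ->
  (forall t s x, 0 <= s <= t -> UBF t s x = UU t s x +
    bochner_integral mu `[s, t] (fun r => UU t r (B r (F r (UBF r s x))))) ->
  forall t s x, 0 <= s <= t -> UU t s x = UBF t s x -
    Gop UU (multiplication_op B (multiplication_op F (trajectory UBF s x))) t.
Proof.
move=> hB hF hUBF sUBF hfb t s x st; have /andP[s0 _] := st.
have hu := uniformly_Lp_mul p1 hB (uniformly_Lp_mul p1 hF (uniformly_Lp_stable p1 hUBF sUBF)).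
have [su uoo] := uniformly_Lp_lty x hu s0.
rewrite (Gop_from hUU hUUb (pow_integral_locally_bochner_integrable p1 su uoo) st).
  rewrite hfb// -addrA [X in _ + X](_ : _ = 0) ?addr0//.
  apply/eqP; rewrite subr_eq0; apply/eqP; apply: bochner_integral_ext => r.
  rewrite /= in_itv/= => /andP[sr _].
  by rewrite /multiplication_op /trajectory sr.
move=> r /andP[r0 rs]; rewrite /multiplication_op /trajectory leNgt rs/=.
by rewrite (Linfty_strong0 hF)// (Linfty_strong0 hB).
Qed.

(** The assumed bound on the outputs puts [K y] in L^p, hence makes it locally integrable, which
    [Gop_from] for [UKC] requires. In [stabilized_trajectory] the corresponding bound follows from
    stability of [UBF]. *)
Lemma detected_trajectory (C : R -> X -> Y) (K : R -> Y -> X) (UKC : R -> R -> X -> X) :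
  Linfty_strong C -> Linfty_strong K -> evolution_family UKC -> exponentially_stable UKC ->
  (forall t s x, 0 <= s <= t -> UKC t s x = UU t s x +
    bochner_integral mu `[s, t] (fun r => UKC t r (K r (C r (UU r s x))))) ->
  uniformly_Lp p (fun s x => multiplication_op C (trajectory UU s x)) ->
  forall t s x, 0 <= s <= t -> UU t s x = UKC t s x -
    Gop UKC (multiplication_op K (multiplication_op C (trajectory UU s x))) t.
Proof.
move=> hC hK hUKC sUKC hfb hu t s x st; have /andP[s0 _] := st.
have [su uoo] := uniformly_Lp_lty x (uniformly_Lp_mul p1 hK hu) s0.
have hb := exponentially_stable_bounded sUKC.
rewrite (Gop_from hUKC hb (pow_integral_locally_bochner_integrable p1 su uoo) st).
  rewrite hfb// -addrA [X in _ + X](_ : _ = 0) ?addr0//.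
  apply/eqP; rewrite subr_eq0; apply/eqP; apply: bochner_integral_ext => r.
  rewrite /= in_itv/= => /andP[sr _].
  by rewrite /multiplication_op /trajectory sr.
move=> r /andP[r0 rs]; rewrite /multiplication_op /trajectory leNgt rs/=.
by rewrite (Linfty_strong0 hC)// (Linfty_strong0 hK).
Qed.

Lemma output_trajectory_strongly_measurable (C : R -> X -> Y) s x : Linfty_strong C -> 0 <= s ->
  strongly_measurable mu Rplus (multiplication_op C (trajectory UU s x)).
Proof.
move=> /(multiplication_bounded p1)[c _ hC] s0.
by have [] := hC _ (trajectory_strongly_measurable hUU x s0).
Qed.

(** The common last step for (iv) and (v), which differ only in how the outputs are bounded. *)
Lemma detectable_stable (C : R -> X -> Y) : Linfty_strong C -> detectable UU C ->
  uniformly_Lp p (fun s x => multiplication_op C (trajectory UU s x)) ->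
  exponentially_stable UU.
Proof.
move=> hC [K [UKC [hK hUKC sUKC hfb]]] hu.
have [c c0 hc] := Gop_pow_integral hUKC p1 sUKC.
have hG := uniformly_Lp_op c0 hc (uniformly_Lp_mul p1 hK hu).
apply: (uniformly_Lp_datko p1 hUU hUUb).
apply: (uniformly_Lp_le p1 (uniformly_Lp_stable p1 hUKC sUKC) hG).
  by move=> s x; exact: trajectory_strongly_measurable.
move=> s x t s0 t0; rewrite /trajectory; case: ifPn => [st|_]; last first.
  by rewrite rnorm0 addr_ge0// rnorm_ge0.
rewrite (detected_trajectory hC hK hUKC sUKC hfb hu) ?s0//.
exact: rnormB.
Qed.

End Feedback.

(** * The implications between the five statements *)

Section Equivalence.
Context {R : realType} (X U Y : completeNormedModType R[i]).
Local Notation mu := (@lebesgue_measure R).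
Variables (p : R) (p1 : 1 <= p).
Variables (B : R -> U -> X) (hB : Linfty_strong B).
Variables (C : R -> X -> Y) (hC : Linfty_strong C).
Variables (UU : R -> R -> X -> X) (hUU : evolution_family UU).
Hypothesis (hUUb : exponentially_bounded UU).

(** The zero feedback works: the closed-loop family is [UU] itself and the integral term
    vanishes. *)
Lemma stable_stabilizable : exponentially_stable UU -> stabilizable UU B.
Proof.
move=> st; exists (fun _ _ => 0), UU; split=> //; first exact: Linfty_strong_zero.
move=> t s x /andP[s0 ts]; rewrite bochner_integral_eq0 ?addr0// => r /andP[sr rt].
have r0 := le_trans s0 sr.
by rewrite (Linfty_strong0 hB)// (evolution0 hUU)// r0.
Qed.

Lemma stable_detectable : exponentially_stable UU -> detectable UU C.
Proof.
move=> st; exists (fun _ _ => 0), UU; split=> //; first exact: Linfty_strong_zero.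
move=> t s x /andP[s0 ts]; rewrite bochner_integral_eq0 ?addr0// => r /andP[sr rt].
by rewrite (evolution0 hUU)// rt (le_trans s0).
Qed.

Lemma Gop_Lp_scaleD (a : R[i]) (f g : R -> X) :
  strongly_measurable mu Rplus f -> (pow_integral p f < +oo)%E ->
  strongly_measurable mu Rplus g -> (pow_integral p g < +oo)%E ->
  forall t, 0 <= t -> Gop UU (fun r => a *: f r + g r) t = a *: Gop UU f t + Gop UU g t.
Proof.
move=> sf foo sg goo t t0.
have lf := pow_integral_locally_bochner_integrable p1 sf foo.
have lg := pow_integral_locally_bochner_integrable p1 sg goo.
exact: Gop_scaleD.
Qed.

Lemma stable_Gop : exponentially_stable UU -> Lp_bounded_operator p (Gop UU).
Proof.
move=> /(Gop_pow_integral hUU p1)[c c0 hc].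
by apply: (Lp_bounded_operatorI p1 c0 hc); exact: Gop_Lp_scaleD.
Qed.

Lemma input_Lp (u : R -> U) : strongly_measurable mu Rplus u -> (pow_integral p u < +oo)%E ->
  strongly_measurable mu Rplus (multiplication_op B u) /\
  (pow_integral p (multiplication_op B u) < +oo)%E.
Proof.
have [b b0 hb] := multiplication_bounded p1 hB.
move=> su uoo; have [sBu Bu] := hb u su; split; first exact: sBu.
by apply: (le_lt_trans Bu); rewrite lte_mul_pinfty ?lee_fin.
Qed.

Lemma Gop_input_scaleD (a : R[i]) (f g : R -> U) :
  strongly_measurable mu Rplus f -> (pow_integral p f < +oo)%E ->
  strongly_measurable mu Rplus g -> (pow_integral p g < +oo)%E ->
  forall t, 0 <= t -> Gop UU (multiplication_op B (fun r => a *: f r + g r)) t =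
    a *: Gop UU (multiplication_op B f) t + Gop UU (multiplication_op B g) t.
Proof.
move=> sf foo sg goo t t0.
have [sBf Bfoo] := input_Lp sf foo; have [sBg Bgoo] := input_Lp sg goo.
rewrite -(Gop_Lp_scaleD a sBf Bfoo sBg Bgoo t0).
apply: bochner_integral_ext => r; rewrite /= in_itv/= => /andP[r0 _].
by rewrite /multiplication_op (Linfty_strong_linear hB).
Qed.

Lemma stable_GB : exponentially_stable UU ->
  Lp_bounded_operator p (fun u => Gop UU (multiplication_op B u)).
Proof.
move=> /(Gop_pow_integral hUU p1)[c c0 hc].
have [b b0 hb] := multiplication_bounded p1 hB.
apply: (@Lp_bounded_operatorI _ _ p1 _ _ _ (c * b)); first exact: mulr_ge0.
  move=> f sf foo; have [sBf Bfoo] := input_Lp sf foo.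
  have [sG hG] := hc _ sBf Bfoo; split; first exact: sG.
  apply: (le_trans hG); rewrite EFinM -muleA; apply: lee_wpmul2l; first by rewrite lee_fin.
  by have [] := hb f sf.
exact: Gop_input_scaleD.
Qed.

(** Stated for a general [A] so as to cover [Gop UU] in (iv) and its composition with [B] in (v).
    Linearity of [A] is assumed at every time, because the criterion [Lp_bounded_operatorI] asks for
    it there. *)
Lemma output_Lp_bounded (V : completeNormedModType R[i]) (A : (R -> V) -> (R -> X)) :
  (forall (a : R[i]) f g, strongly_measurable mu Rplus f -> (pow_integral p f < +oo)%E ->
    strongly_measurable mu Rplus g -> (pow_integral p g < +oo)%E ->
    forall t, 0 <= t -> A (fun r => a *: f r + g r) t = a *: A f t + A g t) ->
  Lp_bounded_operator p A -> Lp_bounded_operator p (fun f => multiplication_op C (A f)).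
Proof.
move=> Alin /(Lp_bounded_operatorE p1)[c c0 hc].
have [b b0 hb] := multiplication_bounded p1 hC.
apply: (@Lp_bounded_operatorI _ _ p1 _ _ _ (b * c)); first exact: mulr_ge0.
  move=> f sf foo; have [sA hA] := hc f sf foo.
  have [sCA hCA] := hb _ sA; split; first exact: sCA.
  apply: (le_trans hCA); rewrite EFinM -muleA.
  by apply: lee_wpmul2l; [rewrite lee_fin|exact: hA].
move=> a f g sf foo sg goo t t0.
by rewrite /multiplication_op (Alin a f g)// (Linfty_strong_linear hC).
Qed.

Lemma Gop_bounded_stable : Lp_bounded_operator p (Gop UU) -> exponentially_stable UU.
Proof.
move=> hG; apply: (uniformly_Lp_datko p1 hUU hUUb).
have h0 := uniformly_Lp_initial p1 hUU hUUb.
apply: (uniformly_Lp_le p1 h0 (uniformly_Lp_bounded_op p1 hG h0)).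
  by move=> s x; exact: trajectory_strongly_measurable.
(* Up to time [s + 1] the trajectory coincides with the input segment, afterwards with its image
   under [Gop UU]; the sum of the two norms dominates it everywhere. *)
move=> s x t s0 t0; have [ts|ts] := leP t (s + 1).
  by rewrite initial_trajectoryE// lerDl rnorm_ge0.
rewrite (Gop_initial_trajectory hUU _ s0 (ltW ts)).
rewrite /trajectory; case: ifPn => _; first by rewrite lerDr rnorm_ge0.
by rewrite rnorm0 addr_ge0// rnorm_ge0.
Qed.

Lemma stabilizable_GB_stable : stabilizable UU B ->
  Lp_bounded_operator p (fun u => Gop UU (multiplication_op B u)) ->
  exponentially_stable UU.
Proof.
move=> [F [UBF [hF hUBF sUBF hfb]]] hG; apply: (uniformly_Lp_datko p1 hUU hUUb).
have hst := uniformly_Lp_stable p1 hUBF sUBF.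
have hGu := uniformly_Lp_bounded_op p1 hG (uniformly_Lp_mul p1 hF hst).
apply: (uniformly_Lp_le p1 hst hGu).
  by move=> s x; exact: trajectory_strongly_measurable.
move=> s x t s0 t0; rewrite /trajectory; case: ifPn => [st|_]; last first.
  by rewrite rnorm0 addr_ge0// rnorm_ge0.
rewrite (stabilized_trajectory p1 hUU hUUb hB hF hUBF sUBF hfb) ?s0//.
exact: rnormB.
Qed.

Lemma detectable_CG_stable : detectable UU C ->
  Lp_bounded_operator p (fun f => multiplication_op C (Gop UU f)) ->
  exponentially_stable UU.
Proof.
move=> hdet hG; apply: (detectable_stable p1 hUU hUUb hC hdet).
have h0 := uniformly_Lp_initial p1 hUU hUUb.
have hGu := uniformly_Lp_bounded_op p1 hG h0.
apply: (uniformly_Lp_le p1 (uniformly_Lp_mul p1 hC h0) hGu).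
  by move=> s x; exact: output_trajectory_strongly_measurable.
move=> s x t s0 t0; have [ts|ts] := leP t (s + 1).
  by rewrite /multiplication_op initial_trajectoryE// lerDl rnorm_ge0.
rewrite /multiplication_op (Gop_initial_trajectory hUU _ s0 (ltW ts)).
rewrite /trajectory; case: ifPn => _; first by rewrite lerDr rnorm_ge0.
by rewrite (Linfty_strong0 hC)// rnorm0 addr_ge0// rnorm_ge0.
Qed.

Lemma stabilizable_detectable_CGB_stable : stabilizable UU B -> detectable UU C ->
  Lp_bounded_operator p (fun u => multiplication_op C (Gop UU (multiplication_op B u))) ->
  exponentially_stable UU.
Proof.
move=> [F [UBF [hF hUBF sUBF hfb]]] hdet hG.
apply: (detectable_stable p1 hUU hUUb hC hdet).
have hst := uniformly_Lp_stable p1 hUBF sUBF.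
have hGu := uniformly_Lp_bounded_op p1 hG (uniformly_Lp_mul p1 hF hst).
apply: (uniformly_Lp_le p1 (uniformly_Lp_mul p1 hC hst) hGu).
  by move=> s x; exact: output_trajectory_strongly_measurable.
move=> s x t s0 t0; rewrite /multiplication_op /trajectory; case: ifPn => [st|_]; last first.
  by rewrite (Linfty_strong0 hC)// rnorm0 addr_ge0// rnorm_ge0.
rewrite (stabilized_trajectory p1 hUU hUUb hB hF hUBF sUBF hfb) ?s0//.
rewrite (Linfty_strongB _ _ hC)//.
exact: rnormB.
Qed.

End Equivalence.

Theorem theorem5p3 (R : realType) (X U Y : completeNormedModType R[i]) (p : R)
    (hp : 1 <= p)
    (B : R -> U -> X) (hB : Linfty_strong B)
    (C : R -> X -> Y) (hC : Linfty_strong C)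
    (UU : R -> R -> X -> X) (hUU : evolution_family UU)
    (hUUb : exponentially_bounded UU) :
  [<-> exponentially_stable UU;
       Lp_bounded_operator p (Gop UU);
       stabilizable UU B /\
         Lp_bounded_operator p (fun u => Gop UU (multiplication_op B u));
       detectable UU C /\
         Lp_bounded_operator p (fun f => multiplication_op C (Gop UU f));
       (stabilizable UU B /\ detectable UU C) /\
         Lp_bounded_operator p
           (fun u => multiplication_op C (Gop UU (multiplication_op B u)))].
Proof.
have sB : exponentially_stable UU -> stabilizable UU B by exact: stable_stabilizable.
have sC : exponentially_stable UU -> detectable UU C by exact: stable_detectable.
(* Every link of the cycle first recovers (i) and then deduces the next statement from stability. *)
tfae.
- exact: stable_Gop.
- by move=> /(Gop_bounded_stable hp hUU hUUb) st; split; [exact: sB|exact: stable_GB].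
- move=> [hs /(stabilizable_GB_stable hp hB hUU hUUb hs) st]; split; first exact: sC.
  by apply: output_Lp_bounded => //; [exact: Gop_Lp_scaleD|exact: stable_Gop].
- move=> [hd /(detectable_CG_stable hp hC hUU hUUb hd) st]; split.
    by split; [exact: sB|exact: sC].
  by apply: output_Lp_bounded => //; [exact: Gop_input_scaleD|exact: stable_GB].
- by move=> [[hs hd]]; exact: stabilizable_detectable_CGB_stable.
Qed.
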